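(* There is an absolute constant $c>0$ (independent of the dimensionality of $\mathcal X$) such that the following holds. Take any $h\in\mathbb R^d$. Let $R$ be a $k\times d$ subgaussian random matrix with i.i.d. entries, $k\le d$. For any $\delta\in(0,1)$, the compressive ERM classifier $(\hat h_R,b)$ satisfies, with probability $1-2\delta$, $$\Pr_{x,y}[(\hat h_R^TRx+b)y\le 0]\le \frac1N\sum_{n=1}^N\mathbf 1(h^Tx_ny_n\le 0)+c\sqrt{\frac{k+1+\log(1/\delta)}{N}}+\frac1N\sum_{n=1}^N f_k^+(\theta^h_{x_ny_n})+\min\left\{\frac{1-\delta}{\delta}\cdot\frac1N\sum_{n=1}^N f_k^+(\theta^h_{x_ny_n}),\ \sqrt{\tfrac12\log\tfrac1\delta}\right\}.$$ Likewise, with probability $1-2\delta$, $$\Pr_{x,y}[(\hat h_R^TRx+b)y\le 0]\le \Pr_{x,y}[h^{*T}xy\le 0]+2c\sqrt{\frac{k+1+\log(1/\delta)}{N}}+\mathrm E_{x,y}[f_k^+(\theta^{h^*}_{xy})]+\min\left\{\frac{1-\delta}{\delta}\cdot\mathrm E_{x,y}[f_k^+(\theta^{h^*}_{xy})],\ \sqrt{\tfrac12\log\tfrac1\delta}\right\}.$$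
   Context: Setting: $\mathcal X\subseteq\mathbb R^d$, $\mathcal D$ is an unknown distribution on $\mathcal X\times\{-1,1\}$, and $\mathcal T^N=\{(x_n,y_n)\}_{n=1}^N$ is a training set drawn i.i.d. from $\mathcal D$. The matrix $R\in\mathbb R^{k\times d}$ is random, drawn independently of the data (random projection). ''Subgaussian with i.i.d. entries'' means the entries are i.i.d. copies of a zero-mean random variable $X$ for which there is $\sigma^2>0$ with $\mathrm E[\exp(\lambda X)]\le\exp(\sigma^2\lambda^2/2)$ for all $\lambda\in\mathbb R$. Compressive ERM classifier: given $R$ and $\mathcal T^N$, $(\hat h_R,b)\in\mathbb R^k\times\mathbb R$ is a minimizer of the empirical zero-one error $\frac1N\sum_{n=1}^N\mathbf 1((h_R^TRx_n+b)y_n\le 0)$ over all $(h_R,b)\in\mathbb R^k\times\mathbb R$; the classifier is $Rx\mapsto\mathrm{sign}(\hat h_R^TRx+b)$. $h^*\in\mathbb R^d$ denotes the optimal homogeneous linear classifier, i.e. a minimizer over $h\in\mathbb R^d$ of the zero-one risk $\Pr_{x,y}[h^Txy\le 0]$. For $u,h\in\mathbb R^d$, $\theta_u^h$ is the angle between $u$ and $h$. The flipping probability is $f_k(\theta_u^h):=\Pr_R\{h^TR^TRu\le 0\}$ (for the given distribution of $R$; for general subgaussian $R$ the value is attached to the pair $(h,u)$), and $f_k^+(\theta_u^h):=f_k(\theta_u^h)\cdot\mathbf 1(h^Tu>0)$. $\Pr_{x,y}$ and $\mathrm E_{x,y}$ are with respect to a fresh $(x,y)\sim\mathcal D$, conditionally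 on $\mathcal T^N$ and $R$; ''with probability $1-2\delta$'' is with respect to the draws of $\mathcal T^N$ and $R$. $\mathbf 1(\cdot)$ is the indicator function. *)

(* Defs.v *)
From HB Require Import structures.
From mathcomp Require Import all_boot all_order all_algebra.
From mathcomp Require Import all_classical all_reals all_analysis.

Set Implicit Arguments.
Unset Strict Implicit.
Unset Printing Implicit Defensive.

Import Order.TTheory GRing.Theory Num.Theory.
Import numFieldNormedType.Exports.

Local Open Scope classical_set_scope.
Local Open Scope ring_scope.

(* Matrices carry the product sigma-algebra, generated by the entries; for a
   realType of coefficients this is the Borel sigma-algebra. *)
Definition matrix_display : measure_display -> measure_display.
Proof. exact. Qed.

Definition matrix_measurable d (T : measurableType d) (m n : nat) :
    set (set 'M[T]_(m, n)) :=
  <<s [set B | exists i j, exists2 A : set T,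
         measurable A & B = [set M : 'M[T]_(m, n) | A (M i j)]] >>.

Section matrix_sigma_algebra.
Context d (T : measurableType d) (m n : nat).

Let matrix_set0 : @matrix_measurable _ T m n set0.
Proof. exact: sigma_algebra0. Qed.

Let matrix_setC A :
  @matrix_measurable _ T m n A -> @matrix_measurable _ T m n (~` A).
Proof. exact: sigma_algebraC. Qed.

Let matrix_bigcup (F : (set 'M[T]_(m, n))^nat) :
  (forall i, @matrix_measurable _ T m n (F i)) ->
  @matrix_measurable _ T m n (\bigcup_i F i).
Proof. exact: sigma_algebra_bigcup. Qed.

HB.instance Definition _ := @isMeasurable.Build (matrix_display d)
  'M[T]_(m, n) (@matrix_measurable _ T m n)
  matrix_set0 matrix_setC matrix_bigcup.

End matrix_sigma_algebra.

Section probability_notions.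
Context dO (Omega : measurableType dO) (R : realType) (P : probability Omega R).

Definition Pr (A : set Omega) : R := fine (P A).

(* Stated through an inner measurable event, so that it is meaningful for every
   A; when A is measurable it amounts to p <= Pr A. *)
Definition with_probability (p : R) (A : set Omega) : Prop :=
  exists E : set Omega, [/\ measurable E, p <= Pr E & E `<=` A].

(* The product rule for subfamilies is the case where some A i are setT. *)
Definition mutually_independent (I : finType) d' (T' : measurableType d')
    (X : I -> Omega -> T') : Prop :=
  forall A : I -> set T', (forall i, measurable (A i)) ->
    Pr [set w | forall i, A i (X i w)] = \prod_(i : I) Pr (X i @^-1` A i).

Definition independent_pair d1 (T1 : measurableType d1)
    d2 (T2 : measurableType d2) (X : Omega -> T1) (Y : Omega -> T2) : Prop :=
  forall A B, measurable A -> measurable B ->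
    Pr (X @^-1` A `&` Y @^-1` B) = Pr (X @^-1` A) * Pr (Y @^-1` B).

Definition has_law d' (T' : measurableType d')
    (X : Omega -> T') (mu : set T' -> \bar R) : Prop :=
  forall A, measurable A -> P (X @^-1` A) = mu A.

Definition subgaussian (X : {RV P >-> R}) : Prop :=
  ('E_P[X] = 0)%E /\
  exists2 sigma2 : R, 0 < sigma2 &
    forall lambda : R,
      ('M_P X lambda <= (expR (sigma2 * lambda ^+ 2 / 2))%:E)%E.

Definition iid_sample d' (T' : measurableType d') (D : probability T' R)
    (N : nat) (TN : {RV P >-> N.-tuple T'}) : Prop :=
  mutually_independent (fun (n : 'I_N) w => tnth (TN w) n) /\
  forall n : 'I_N, has_law (fun w => tnth (TN w) n) D.

Definition iid_entries (k d : nat) (M : {RV P >-> 'M[R]_(k, d)})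
    (mu : set R -> \bar R) : Prop :=
  mutually_independent (fun (ij : 'I_k * 'I_d) w => M w ij.1 ij.2) /\
  forall i j, has_law (fun w => M w i j) mu.

End probability_notions.

Section classification.
Context (R : realType).

Definition dot (n : nat) (u v : 'cV[R]_n) : R := (u^T *m v) 0 0.

Definition average (N : nat) (F : 'I_N -> R) : R :=
  N%:R^-1 * \sum_(n < N) F n.

Definition linear_errs (d : nat) (h : 'cV[R]_d) (z : 'cV[R]_d * R) : bool :=
  dot h z.1 * z.2 <= 0.

Definition projected_errs (k d : nat) (M : 'M[R]_(k, d)) (g : 'cV[R]_k) (b : R)
    (z : 'cV[R]_d * R) : bool :=
  (dot g (M *m z.1) + b) * z.2 <= 0.

Definition empirical_error (d N : nat) (errs : 'cV[R]_d * R -> bool)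
    (t : N.-tuple ('cV[R]_d * R)) : R :=
  average (fun n : 'I_N => (errs (tnth t n))%:R).

Definition risk (d : nat) (D : probability ('cV[R]_d * R)%type R)
    (errs : 'cV[R]_d * R -> bool) : R :=
  Pr D [set z | errs z].

Definition compressive_ERM (k d N : nat) (M : 'M[R]_(k, d))
    (t : N.-tuple ('cV[R]_d * R)) (g : 'cV[R]_k) (b : R) : Prop :=
  forall (g' : 'cV[R]_k) (b' : R),
    empirical_error (projected_errs M g b) t <=
    empirical_error (projected_errs M g' b') t.

Definition optimal_linear (d : nat) (D : probability ('cV[R]_d * R)%type R)
    (h : 'cV[R]_d) : Prop :=
  forall h' : 'cV[R]_d, risk D (linear_errs h) <= risk D (linear_errs h').

(* f_k and f_k^+; for a general subgaussian matrix these depend on the pair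
   (h, u) and not only on the angle between h and u. *)
Definition flip_prob dO (Omega : measurableType dO) (P : probability Omega R)
    (k d : nat) (M : Omega -> 'M[R]_(k, d)) (h u : 'cV[R]_d) : R :=
  Pr P [set w | (h^T *m (M w)^T *m M w *m u) 0 0 <= 0].

Definition flip_prob_pos dO (Omega : measurableType dO)
    (P : probability Omega R) (k d : nat) (M : Omega -> 'M[R]_(k, d))
    (h u : 'cV[R]_d) : R :=
  flip_prob P M h u * (0 < dot h u)%R%:R.

(* F + min {(1 - delta) / delta * F, sqrt (1/2 * log (1 / delta))} *)
Definition flip_penalty (delta F : R) : R :=
  F + Num.min ((1 - delta) / delta * F) (Num.sqrt (2^-1 * ln (delta^-1))).

Definition complexity (k N : nat) (delta : R) : R :=
  Num.sqrt ((k%:R + 1 + ln (delta^-1)) / N%:R).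

End classification.

(* Main.v *)
Require Import Defs.
From HB Require Import structures.
From mathcomp Require Import all_boot all_order all_algebra.
From mathcomp Require Import all_classical all_reals all_analysis.
From mathcomp Require Import measurable_realfun ring lra.

Set Implicit Arguments.
Unset Strict Implicit.
Unset Printing Implicit Defensive.

Import Order.TTheory GRing.Theory Num.Theory.
Import numFieldNormedType.Exports.

(* Given the projection matrix M, the sets {(g . Mx + b) y <= c} are half-spaces
   in k + 2 dimensions, hence have VC dimension at most k + 2. Uniform deviation
   with no logarithm of N: symmetrize with a ghost sample, exchange the two
   samples coordinatewise by independent signs, and chain along Hamming nets of
   the traces on the 2N points; Dudley's argument bounds the nets at scale 4^-j
   by (32 * 16^j)^(k + 2), so that the subgaussian tails sum up.

   The parameters are taken rational, with a margin c > 0, so that the bad event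
   is a countable union, measurable jointly in M and the sample: every real
   (g, b, 0) is dominated by some rational (g', b', c), with almost the same risk
   and no larger empirical error.

   The minimizer is then compared with (M h, 0), whose errors are those of h
   plus the flipped points. The flipped mass has conditional mean F over M, and
   Markov's inequality bounds its excess over F by both terms of the minimum. *)

Local Open Scope ring_scope.

(** * The Sauer-Shelah lemma and packing numbers *)

(** The functions [hhat] and [b] are arbitrary, so the event of interest need not be measurable; the
    bad events therefore range over all classifiers and never mention the minimizer. The margin
    answers an asymmetry of [<=]: points of margin zero count as errors, and perturbing [(g, b)] at
    threshold zero could make them correct and lose risk. A small positive threshold keeps them, and
    below half the least positive margin in the sample it adds no empirical error. This domination
    is one-sided, which is all that the minimizer needs; the opposite deviation is used only at
    [(M h, 0)], which joins the countable family as one more index. Independence serves twice: the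
    deviation is bounded for each fixed matrix, the empirical flipped mass for each fixed sample.
    The second bound pays the deviation at the minimizer and at [(M h, 0)], hence [2 c]. *)

Definition shattered (T : finType) (F : {set {set T}}) (S : {set T}) : bool :=
  [forall B : {set T}, (B \subset S) ==> [exists A in F, A :&: S == B]].

Lemma shatteredP (T : finType) (F : {set {set T}}) (S : {set T}) :
  reflect (forall B : {set T}, B \subset S -> exists2 A, A \in F & A :&: S = B)
    (shattered F S).
Proof.
apply: (iffP forallP) => [sFS B BS|sFS B].
  have /implyP/(_ BS)/existsP[A /andP[AF /eqP AS]] := sFS B.
  by exists A.
apply/implyP => /sFS[A AF AS]; apply/existsP; exists A.
by rewrite AF AS eqxx.
Qed.

(* Pajor's form of the Sauer-Shelah lemma *)
Lemma card_le_shattered (T : finType) (F : {set {set T}}) :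
  (#|F| <= #|[set S | shattered F S]|)%N.
Proof.
suff H n : forall (U : {set T}) (G : {set {set T}}), #|U| = n ->
    {in G, forall A : {set T}, A \subset U} ->
    (#|G| <= #|[set S : {set T} | (S \subset U) && shattered G S]|)%N.
  apply: leq_trans (H _ [set: T] F erefl _) _.
    by move=> A _; exact: finset.subsetT.
  by apply: subset_leq_card; apply/fintype.subsetP => S; rewrite !inE => /andP[].
elim: n => [|n IHn] U G cU GU.
  have [->|[A AG]] := set_0Vmem G; first by rewrite cards0.
  have U0 : U = finset.set0 by apply: cards0_eq.
  have G1 B : B \in G -> B = finset.set0.
    by move=> /GU; rewrite U0 finset.subset0 => /eqP.
  apply: (@leq_trans #|[set finset.set0 : {set T}]%SET|).
    by apply: subset_leq_card; apply/fintype.subsetP => B /G1 ->; rewrite inE.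
  apply: subset_leq_card; apply/fintype.subsetP => B; rewrite !inE => /eqP ->.
  rewrite finset.sub0set; apply/shatteredP => C; rewrite finset.subset0 => /eqP ->.
  by exists A => //; rewrite finset.setI0.
have /card_gt0P[x xU] : (0 < #|U|)%N by rewrite cU.
set U' := (U :\ x)%SET.
have cU' : #|U'| = n by move: cU; rewrite (cardsD1 x) xU add1n => -[].
pose G0 := [set A in G | x \notin A]%SET.
pose G1 := [set A in G | x \in A]%SET.
pose G1' := [set (A :\ x)%SET | A in G1]%SET.
have cG : #|G| = (#|G0| + #|G1'|)%N.
  rewrite card_in_imset; last first.
    move=> A B; rewrite !inE => /andP[_ xA] /andP[_ xB] AB.
    by rewrite -(finset.setD1K xA) AB finset.setD1K.
  have -> : G = (G0 :|: G1)%SET.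
    by apply/finset.setP => A; rewrite !inE; case: (x \in A); rewrite !(andbF, andbT, orbF).
  rewrite cardsU (_ : G0 :&: G1 = finset.set0)%SET ?cards0 ?subn0//.
  apply/finset.setP => A; rewrite !inE.
  by case: (x \in A); rewrite !(andbF, andbT).
have sG0 : {in G0, forall A : {set T}, A \subset U'}.
  move=> A; rewrite inE => /andP[/GU AU xA].
  by rewrite subsetD1 AU.
have sG1' : {in G1', forall A : {set T}, A \subset U'}.
  by move=> _ /imsetP[A + ->]; rewrite inE => /andP[/GU AU xA]; exact: finset.setSD.
pose sh0 := [set S : {set T} | (S \subset U') && shattered G0 S]%SET.
pose sh1 := [set S : {set T} | (S \subset U') && shattered G1' S]%SET.
apply: (@leq_trans (#|sh0| + #|sh1|)).
  by rewrite cG leq_add// IHn.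
have sU (S : {set T}) : S \subset U' -> S \subset U.
  by rewrite subsetD1 => /andP[].
have xS (S : {set T}) : S \subset U' -> x \notin S by rewrite subsetD1 => /andP[].
(* A set shattered by [G0] or [G1'] is shattered by [G]; one shattered by both stays so when [x] is
   added. As it avoids [x], the sets [x |: S] are new and account for the intersection term. *)
rewrite -cardsUI.
have inj : {in (sh0 :&: sh1)%SET &, injective (fun S => x |: S)%SET}.
  move=> S S'; rewrite !inE => /andP[/andP[SU _] _] /andP[/andP[S'U _] _] e.
  by rewrite -(setU1K (xS _ SU)) e setU1K// xS.
rewrite -(card_in_imset inj).
set sh2 := imset _ _.
have d2 : [disjoint (sh0 :|: sh1)%SET & sh2].
  rewrite -setI_eq0; apply/eqP/setP => S; rewrite !inE.
  apply/negP => /andP[S01 /imsetP[S' _ SE]].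
  have : x \notin S by case/orP: S01 => /andP[+ _]; exact: xS.
  by rewrite SE setU11.
move: d2; rewrite -leq_card_setU => /eqP <-.
apply: subset_leq_card; apply/fintype.subsetP => S /finset.setUP[|].
  move=> /finset.setUP[]; rewrite !inE => /andP[SU sh]; rewrite (sU _ SU)/=.
    apply/shatteredP => B /(shatteredP _ _ sh)[A]; rewrite inE => /andP[AG _] AS.
    by exists A.
  apply/shatteredP => B /(shatteredP _ _ sh)[_ /imsetP[A + ->]].
  rewrite inE => /andP[AG xA] AS; exists A => //.
  rewrite -AS; apply/setP => y; rewrite !inE.
  by case: eqP => // ->; rewrite (negbTE (xS _ SU)) !andbF.
move=> /imsetP[S' + ->]; rewrite !inE => /andP[/andP[SU sh0S] /andP[_ sh1S]].
rewrite finset.subUset finset.sub1set xU (sU _ SU)/=.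
apply/shatteredP => B Bs.
have [xB|xB] := boolP (x \in B).
  have /(shatteredP _ _ sh1S)[_ /imsetP[A + ->] AS] : (B :\ x \subset S')%SET.
    by rewrite subDset.
  rewrite inE => /andP[AG xA]; exists A => //.
  apply/setP => y; rewrite !inE; have [->|yx]/= := eqVneq y x.
    by rewrite xA xB.
  by move/setP : AS => /(_ y); rewrite !inE yx/= => ->.
have /(shatteredP _ _ sh0S)[A + AS] : B \subset S'.
  apply/fintype.subsetP => y yB; move/fintype.subsetP: Bs => /(_ _ yB); rewrite !inE.
  by move=> /orP[/eqP yx|//]; rewrite -yx yB in xB.
rewrite inE => /andP[AG xA]; exists A => //.
apply/setP => y; rewrite !inE; have [->|yx]/= := eqVneq y x.
  by rewrite (negbTE xA) (negbTE xB).
by move/setP : AS => /(_ y); rewrite !inE.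
Qed.


(** Each shattered set has weight [x ^+ #|S| >= x ^+ V] in the expansion of [(1 + x) ^+ #|T|] over
    subsets. The free [x] replaces the usual estimate of a sum of binomial coefficients. *)
Lemma card_vc_le (R : realFieldType) (T : finType) (F : {set {set T}}) (V : nat)
    (x : R) : (forall S, shattered F S -> (#|S| <= V)%N) -> 0 < x -> x <= 1 ->
  #|F|%:R * x ^+ V <= (1 + x) ^+ #|T|.
Proof.
move=> FV x0 x1.
have -> : (1 + x) ^+ #|T| = \sum_(S : {set T}) x ^+ #|S|.
  rewrite addrC -prodr_const bigA_distr; apply: eq_bigr => S _.
  by rewrite -big_mkcond/= prodr_const.
apply: (@le_trans _ _ (\sum_(S | shattered F S) x ^+ V)).
  rewrite sumr_const -[leRHS]mulr_natl ler_wpM2r ?exprn_ge0 ?(ltW x0)//.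
  by rewrite ler_nat; apply: leq_trans (card_le_shattered F) _; rewrite cardsE.
apply: (@le_trans _ _ (\sum_(S | shattered F S) x ^+ #|S|)).
  apply: ler_sum => S /FV SV; exact: (ler_wiXn2l (ltW x0) x1 SV).
rewrite [leRHS](bigID (shattered F))/= lerDl sumr_ge0// => S _.
by rewrite exprn_ge0 // ltW.
Qed.

Definition hamming (T : finType) (A B : {set T}) : nat :=
  #|[set i | (i \in A) != (i \in B)]%SET|.

(* Random sampling: a uniformly random map ['I_n -> T] separates all the pairs
   of [F] with positive probability. *)
Lemma exists_separating_sample (R : realFieldType) (T : finType)
    (F : {set {set T}}) (e : R) (n : nat) : (0 < #|T|)%N -> e <= 1 ->
  {in F &, forall A B : {set T}, A != B -> e * #|T|%:R <= (hamming A B)%:R} ->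
  #|F|%:R ^+ 2 * (1 - e) ^+ n < 1 ->
  exists s : {ffun 'I_n -> T},
    {in F &, injective (fun A : {set T} => [set i | s i \in A]%SET)}.
Proof.
move=> T0 e1 Fe Fn.
(* The samples that fail to separate the pair [p]. If every sample failed for some pair, the union
   bound over [FF] would count fewer than [#|T| ^ n] samples. *)
pose col (p : {set T} * {set T}) :=
  [set s : {ffun 'I_n -> T} | [forall i, (s i \in p.1) == (s i \in p.2)]]%SET.
pose FF := [set p : {set T} * {set T} |
  [&& p.1 \in F, p.2 \in F & p.1 != p.2]]%SET.
have [allcol|/forallPn[s]] := boolP [forall s, s \in \bigcup_(p in FF) col p]%SET.
- have : (#|{ffun 'I_n -> T}| <= \sum_(p in FF) #|col p|)%N.
    apply: leq_trans (_ : #|\bigcup_(p in FF) col p|%SET <= _)%N.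
      by apply: subset_leq_card; apply/fintype.subsetP => s _; move/forallP: allcol.
    apply: (big_ind2 (fun (A : {set _}) m => #|A| <= m)%N) => //; first by rewrite cards0.
    move=> A m B k Am Bk; apply: leq_trans (leq_add Am Bk).
    by rewrite cardsU leq_subr.
  rewrite card_ffun card_ord -(ler_nat R) natrX natr_sum.
  suff H : \sum_(p in FF) (#|col p|%:R : R) < #|T|%:R ^+ n.
    by move=> /le_lt_trans/(_ H); rewrite ltxx.
  apply: (@le_lt_trans _ _ (\sum_(p in FF) ((1 - e) * #|T|%:R) ^+ n)).
    apply: ler_sum => -[A B]; rewrite inE/= => /and3P[AF BF AB].
    have -> : #|col (A, B)| = ((#|T| - hamming A B) ^ n)%N.
      rewrite -(cardsC [set i | (i \in A) != (i \in B)]%SET) addKn.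
      rewrite -[in RHS](card_ord n) -card_ffun_on.
      apply: eq_card => s; rewrite !inE/=.
      apply/forallP/ffun_onP => H i; have := H i; rewrite !inE/=.
        by move=> ->.
      by rewrite negbK.
    rewrite natrX lerXn2r ?nnegrE ?mulr_ge0 ?subr_ge0// natrB; last exact: max_card.
    by rewrite mulrBl mul1r lerD2l lerN2 Fe.
  rewrite sumr_const exprMn -mulrnAl -[ltRHS]mul1r ltr_pM2r ?exprn_gt0 ?ltr0n//.
  apply: le_lt_trans Fn; rewrite -mulr_natl ler_wpM2r ?exprn_ge0 ?subr_ge0//.
  rewrite -natrX ler_nat expnS expn1 -cardsX; apply: subset_leq_card.
  by apply/fintype.subsetP => p; rewrite !inE => /and3P[-> ->].
- move=> sN; exists s => A B AF BF AB; apply/eqP/negPn/negP => nAB.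
  move/negP: sN; apply; apply/bigcupP; exists (A, B); first by rewrite inE AF BF.
  rewrite inE/=; apply/forallP => i; apply/eqP.
  by move/finset.setP: AB => /(_ i); rewrite !inE.
Qed.

(** A preimage that contains [i] contains every index with the same image, so cutting out [[set i]]
    forces [s] to be injective on [S]: repeated sample points cannot enlarge a shattered set. *)
Lemma shattered_preim (T U : finType) (F : {set {set T}}) (s : U -> T)
    (S : {set U}) :
  shattered [set [set i | s i \in A]%SET | A : {set T} in F] S ->
  {in S &, injective s} /\ shattered F [set s i | i in S].
Proof.
move=> /shatteredP sS; split.
  move=> i j iS jS sij; have [_ /imsetP[A _ ->] AS] := sS [set i]%SET ltac:(by rewrite finset.sub1set).
  have: j \in [set i]%SET by rewrite -AS !inE jS -sij andbT; move/finset.setP: AS => /(_ i); rewrite !inE iS eqxx andbT.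
  by rewrite inE => /eqP.
apply/shatteredP => B BS.
have [_ /imsetP[A AF ->] AS] := sS (S :&: [set i | s i \in B])%SET (finset.subsetIl _ _).
exists A => //; apply/finset.setP => y; rewrite inE.
apply/andP/idP => [[yA /imsetP[i iS yi]]|yB].
  by move/finset.setP: AS => /(_ i); rewrite !inE iS/= -yi yA.
have /imsetP[i iS yi] := fintype.subsetP BS _ yB.
split; last by apply/imsetP; exists i.
by move/finset.setP: AS => /(_ i); rewrite !inE iS/= -yi yB !andbT.
Qed.

Lemma expR_half_le2 (R : realType) : expR (2^-1 : R) <= 2.
Proof.
have := expR_ge1Dx (- 2^-1 : R); rewrite expRN => h.
rewrite -[leRHS]invrK -[leLHS]invrK lef_pV2 ?posrE ?invr_gt0 ?expR_gt0//.
by apply: le_trans h; lra.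
Qed.

(* Dudley's packing bound: [4 / e] appears by testing [card_vc_le] at [x = e / 4]
   on a separating sample of [2 ln #|F| / e] points. *)
Lemma packing_bound (R : realType) (T : finType) (F : {set {set T}}) (V : nat)
    (e : R) : (0 < #|T|)%N -> (0 < V)%N -> 0 < e -> e <= 1 ->
  (forall S, shattered F S -> (#|S| <= V)%N) ->
  {in F &, forall A B : {set T}, A != B -> e * #|T|%:R <= (hamming A B)%:R} ->
  #|F|%:R <= (32 / e ^+ 2) ^+ V.
Proof.
move=> T0 V0 e0 e1 FV Fe.
have [F1|F1] := leqP #|F| 1.
  apply: (@le_trans _ _ 1); first by rewrite lern1.
  rewrite exprn_ege1// ler_pdivlMr ?exprn_gt0// mul1r.
  by apply: (@le_trans _ _ 1); [rewrite exprn_ile1// ltW|rewrite ler1n].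
set m := (#|F|%:R : R).
have m0 : 0 < m by rewrite ltr0n ltnW.
pose a := ln m.
have ma : m = expR a by rewrite lnK.
have a0 : 0 <= a by rewrite ln_ge0// ler1n ltnW.
(* More than [2 a / e] points make [m^2 (1 - e)^n <= exp (2 a - e n) < 1]. *)
pose n := (Num.truncn (2 * a / e)).+1.
have n1 : 2 * a / e < n%:R by exact: truncnS_gt.
have n2 : n%:R <= 2 * a / e + 1.
  rewrite /n -natr1 lerD2r truncn_le//.
  by rewrite divr_ge0 ?mulr_ge0// ltW.
have [s sinj] : exists s : {ffun 'I_n -> T},
    {in F &, injective (fun A : {set T} => [set i | s i \in A]%SET)}.
  apply: (@exists_separating_sample R _ _ e) => //.
  rewrite -/m ma -expRM_natl.
  apply: (@le_lt_trans _ _ (expR (2%:R * a) * expR (- e) ^+ n)).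
    rewrite ler_pM2l ?expR_gt0// lerXn2r ?nnegrE ?subr_ge0 ?expR_ge0//.
    exact: expR_ge1Dx.
  rewrite -expRM_natl -expRD expR_lt1 mulrN subr_lt0.
  by rewrite -ltr_pdivrMr.
pose G := [set [set i | s i \in A]%SET | A : {set T} in F]%SET.
have cG : #|G| = #|F| by rewrite card_in_imset.
have /card_vc_le - /(_ R (e / 4)) : forall S, shattered G S -> (#|S| <= V)%N.
  by move=> S /shattered_preim[inj /FV]; rewrite card_in_imset.
have e40 : 0 < e / 4 by rewrite divr_gt0.
have e41 : e / 4 <= 1 by lra.
rewrite cG -/m card_ord => /(_ e40 e41) h.
(* Since [n e / 4 <= a / 2 + 1/4], the right side is only of order [sqrt m]; solving for [m] squares
   the bound and yields [(16 / e^2)^V exp (1/2)]. *)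
have {}h : m * (e / 4) ^+ V <= expR (a / 2 + 4^-1).
  apply: (le_trans h); apply: (@le_trans _ _ (expR (e / 4) ^+ n)).
    rewrite lerXn2r ?nnegrE ?expR_ge0 ?expR_ge1Dx//.
    by rewrite addr_ge0// ltW.
  rewrite -expRM_natl ler_expR.
  apply: (@le_trans _ _ ((2 * a / e + 1) * (e / 4))); first by rewrite ler_wpM2r // ltW.
  have -> : (2 * a / e + 1) * (e / 4) = a / 2 + e / 4 by field; rewrite gt_eqF.
  by rewrite lerD2l -[leRHS]mul1r ler_wpM2r.
have {}h : expR (a / 2) <= (4 / e) ^+ V * expR 4^-1.
  have -> : 4 / e = (e / 4)^-1 by rewrite invf_div.
  rewrite exprVn [leRHS]mulrC ler_pdivlMr ?exprn_gt0//.
  rewrite -(ler_pM2l (expR_gt0 (a / 2))) mulrA -!expRD -splitr -ma; exact: h.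
have -> : m = expR (a / 2) ^+ 2 by rewrite expr2 -expRD -splitr.
apply: (@le_trans _ _ (((4 / e) ^+ V * expR 4^-1) ^+ 2)).
  by rewrite lerXn2r ?nnegrE ?mulr_ge0 ?expR_ge0// exprn_ge0// divr_ge0// ltW.
rewrite exprMn [expR 4^-1 ^+ 2]expr2 -expRD.
have -> : 4^-1 + 4^-1 = 2^-1 :> R by lra.
have -> : 32 / e ^+ 2 = (4 / e) ^+ 2 * 2.
  by field; rewrite gt_eqF.
rewrite exprAC [leRHS]exprMn ler_wpM2l ?exprn_ge0 ?sqr_ge0//.
  by rewrite divr_ge0// ltW.
apply: (le_trans (expR_half_le2 R)).
by rewrite -[leLHS]expr1 ler_weXn2l// ler1n.
Qed.

(** * Chaining for Rademacher sums *)

(** The exponent [2 x^2], looser than the sharp [x^2 / 2], allows an elementary proof: for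
    [x^2 <= 1/2] sum [exp y <= 1 / (1 - y)] over [y = x] and [y = - x]; otherwise both [x] and [- x]
    are at most [2 x^2]. *)
Lemma expR_cosh_le (R : realType) (x : R) :
  expR x + expR (- x) <= 2 * expR (2 * x ^+ 2).
Proof.
have [x2|x2] := leP (x ^+ 2) (2^-1).
  have x1 : x < 1 by nra.
  have x1' : - 1 < x by nra.
  have inv_bound (y : R) : y < 1 -> expR y <= (1 - y)^-1.
    move=> y1; rewrite -[leLHS]invrK lef_pV2 ?posrE ?invr_gt0 ?expR_gt0 ?subr_gt0//.
    by rewrite -expRN; exact: expR_ge1Dx.
  apply: (@le_trans _ _ ((1 - x)^-1 + (1 + x)^-1)).
    by apply: lerD; [exact: inv_bound|rewrite -[in leRHS](opprK x) inv_bound// ltrNl].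
  apply: (@le_trans _ _ (2 * (1 + 2 * x ^+ 2))); last first.
    by rewrite ler_pM2l// expR_ge1Dx.
  have -> : (1 - x)^-1 + (1 + x)^-1 = 2 / (1 - x ^+ 2).
    field; apply/and3P; split; rewrite gt_eqF//; [lra|lra|nra].
  rewrite ler_pM2l// -[leLHS]mul1r ler_pdivrMr; last by lra.
  by have := sqr_ge0 x; nra.
have h (y : R) : 2^-1 < y ^+ 2 -> expR y <= expR (2 * y ^+ 2).
  by move=> y2; rewrite ler_expR; have := sqr_ge0 (y - 2^-1); nra.
have hN := h (- x); rewrite sqrrN in hN.
by rewrite mulrC mulr_natr mulr2n lerD ?h ?hN.
Qed.

Lemma rademacher_tail (R : realType) (N : nat) (c : 'I_N -> R) (s u : R) :
  0 < s -> 0 <= u -> \sum_(n < N) c n ^+ 2 <= s ->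
  #|[set sg : {ffun 'I_N -> bool} | u < \sum_(n < N) (-1) ^+ sg n * c n]%SET|%:R
  <= 2 ^+ N * expR (- (u ^+ 2 / (8 * s))).
Proof.
move=> s0 u0 cs.
set E := (X in #|X|%:R).
(* Chernoff's parameter: it minimizes [2 s l^2 - l u], with minimum [- u^2 / (8 s)]. *)
pose l := u / (4 * s).
have l0 : 0 <= l by rewrite divr_ge0 ?mulr_ge0// ltW.
have mgf : \sum_(sg : {ffun 'I_N -> bool}) expR (l * \sum_(n < N) (-1) ^+ sg n * c n)
    <= 2 ^+ N * expR (2 * l ^+ 2 * s).
  under eq_bigr do rewrite mulr_sumr expR_sum.
  rewrite -(bigA_distr_bigA (fun (n : 'I_N) (b : bool) => expR (l * ((-1) ^+ b * c n)))).
  apply: (@le_trans _ _ (\prod_(n < N) (2 * expR (2 * (l * c n) ^+ 2)))).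
    apply: ler_prod => n _; rewrite sumr_ge0 => [/=|b _]; last exact: expR_ge0.
    rewrite big_bool/= !expr0 !mul1r expr1 mulN1r mulrN addrC.
    exact: expR_cosh_le.
  rewrite big_split/= prodr_const card_ord -expR_sum ler_pM2l ?exprn_gt0// ler_expR.
  rewrite -mulr_sumr; under eq_bigr do rewrite exprMn.
  by rewrite -mulr_sumr mulrA ler_wpM2l// mulr_ge0 ?sqr_ge0.
have : #|E|%:R * expR (l * u) <= 2 ^+ N * expR (2 * l ^+ 2 * s).
  apply: le_trans mgf; rewrite mulr_natl -sumr_const.
  rewrite [leRHS](bigID (mem E))/= -[leLHS]addr0 lerD//; last first.
    by apply: sumr_ge0 => sg _; exact: expR_ge0.
  apply: ler_sum => sg; rewrite inE => sgu.
  by rewrite ler_expR ler_wpM2l// ltW.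
rewrite -ler_pdivlMr ?expR_gt0// -expRN -[X in _ <= X -> _]mulrA -expRD.
move/le_trans; apply.
rewrite ler_pM2l ?exprn_gt0// ler_expR le_eqVlt; apply/orP; left; apply/eqP.
by rewrite /l; field; rewrite gt_eqF.
Qed.

Lemma rademacher_tail_norm (R : realType) (N : nat) (c : 'I_N -> R) (s u : R) :
  0 < s -> 0 <= u -> \sum_(n < N) c n ^+ 2 <= s ->
  #|[set sg : {ffun 'I_N -> bool} | u < `|\sum_(n < N) (-1) ^+ sg n * c n|]%SET|%:R
  <= 2 ^+ N * (2 * expR (- (u ^+ 2 / (8 * s)))).
Proof.
move=> s0 u0 cs.
have csN : \sum_(n < N) (- c n) ^+ 2 <= s by under eq_bigr do rewrite sqrrN.
have h1 := rademacher_tail s0 u0 cs.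
have h2 := rademacher_tail s0 u0 csN.
rewrite mulrCA [leRHS]mulr_natl [leRHS]mulr2n; apply: le_trans (lerD h1 h2).
rewrite -natrD ler_nat -cardsUI; apply: (@leq_trans #|_ :|: _|%SET); last exact: leq_addr.
apply: subset_leq_card; apply/fintype.subsetP => sg; rewrite !inE.
under [X in _ -> _ || (_ < X)]eq_bigr do rewrite mulrN.
by rewrite sumrN lter_normr.
Qed.

(** [(n, false)] and [(n, true)] index the [n]-th points of the sample and of its ghost; the value
    is [N] times the difference of the two frequencies of [A] after the exchanges prescribed by
    [sg]. *)
Definition swap_dev (R : realType) (N : nat) (A : {set 'I_N * bool})
    (sg : {ffun 'I_N -> bool}) : R :=
  \sum_(n < N) (-1) ^+ sg n * (((n, false) \in A)%:R - ((n, true) \in A)%:R).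

(** If [A] and [B] disagree on [m <= 2] points of a coordinate, its coefficient is at most [m] in
    absolute value, and [m^2 <= 2 m]: the squares sum to at most twice the Hamming distance. *)
Lemma swap_dev_incr (R : realType) (N : nat) (A B : {set 'I_N * bool}) (r u : R) :
  0 < r -> 0 <= u -> (hamming A B)%:R <= r ->
  #|[set sg : {ffun 'I_N -> bool} | u < `|swap_dev R A sg - swap_dev R B sg|]%SET|%:R
  <= 2 ^+ N * (2 * expR (- (u ^+ 2 / (16 * r)))).
Proof.
move=> r0 u0 ABr.
pose c (n : 'I_N) : R := (((n, false) \in A)%:R - ((n, true) \in A)%:R) -
  (((n, false) \in B)%:R - ((n, true) \in B)%:R).
have cE sg : swap_dev R A sg - swap_dev R B sg = \sum_(n < N) (-1) ^+ sg n * c n.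
  by rewrite -sumrB; apply: eq_bigr => n _; rewrite -mulrBr.
under eq_finset do rewrite cE.
have -> : 16 * r = 8 * (2 * r) by ring.
apply: rademacher_tail_norm => //; first by rewrite mulr_gt0.
apply: (@le_trans _ _ (2 * (hamming A B)%:R)); last by rewrite ler_pM2l.
have -> : 2 * (hamming A B)%:R =
    \sum_(n < N) \sum_b 2 * (((n, b) \in A) != ((n, b) \in B))%:R :> R.
  rewrite pair_bigA/= -mulr_sumr -natr_sum; congr (_ * _%:R).
  rewrite /hamming -sum1_card big_mkcond/=; apply: eq_bigr => -[n b] _.
  by rewrite inE/=; case: eqP.
apply: ler_sum => n _; rewrite big_bool/= /c.
by do 4! case: (_ \in _) => /=; lra.
Qed.

(** A maximal [r]-separated subfamily works: a member farther than [r] from all of it could be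
    added. *)
Lemma exists_net (R : realType) (T : finType) (F : {set {set T}}) (r : R) :
  exists G : {set {set T}}, [/\ G \subset F,
    {in G &, forall A B : {set T}, A != B -> r < (hamming A B)%:R} &
    (0 <= r -> {in F, forall A : {set T}, exists2 B : {set T}, B \in G & (hamming A B)%:R <= r})].
Proof.
pose P (G : {set {set T}}) := (G \subset F) &&
  [forall A in G, forall B in G, (A != B) ==> (r < (hamming A B)%:R)].
have hC (A B : {set T}) : hamming A B = hamming B A.
  by apply: eq_card => i; rewrite !inE eq_sym.
have [G /maxsetP[/andP[GF /forall_inP GP] Gmax]] : {G | maxset P G}.
  apply: ex_maxset; exists finset.set0; rewrite /P finset.sub0set.
  by apply/forall_inP => A; rewrite inE.
exists G; split=> //.
  by move=> A B AG BG; move/forall_inP : (GP _ AG) => /(_ _ BG)/implyP.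
move=> r0 A AF; apply: contrapT => noB.
have far B : B \in G -> r < (hamming A B)%:R.
  by move=> BG; rewrite ltNge; apply/negP => BA; apply: noB; exists B.
have : (A |: G)%SET = G.
  apply: Gmax; last exact: finset.subsetUr.
  rewrite /P finset.subUset finset.sub1set AF GF/=.
  apply/forall_inP => B /setU1P[->|BG]; apply/forall_inP => C /setU1P[->|CG]; apply/implyP.
  - by rewrite eqxx.
  - by move=> _; exact: far.
  - by move=> _; rewrite hC; exact: far.
  - by move/forall_inP : (GP _ BG) => /(_ _ CG)/implyP.
move=> AG; apply: noB; exists A; first by rewrite -AG setU11.
rewrite (_ : hamming A A = 0%N)// /hamming; apply: eq_card0 => i.
by rewrite !inE eqxx.
Qed.

(** If [A] in [G J.+1] exceeds the sum up to [u J], then either its neighbour in [G J] exceeds the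
    shorter sum, or the increment between them exceeds [u J], which costs a union bound over
    [G J.+1]. The chain starts at the empty set, whose deviation is zero. *)
Lemma chain_bound (R : realType) (N : nat) (G : nat -> {set {set 'I_N * bool}})
    (r u p : nat -> R) :
  G 0%N = [set finset.set0]%SET ->
  (forall j, 0 < r j) -> (forall j, 0 <= u j) ->
  (forall j, {in G j.+1, forall A : {set _}, exists2 B : {set _},
     B \in G j & (hamming A B)%:R <= r j}) ->
  (forall j, #|G j.+1|%:R * (2 * expR (- (u j ^+ 2 / (16 * r j)))) <= p j) ->
  forall J, #|[set sg : {ffun 'I_N -> bool} |
      [exists A in G J, \sum_(j < J) u j < `|swap_dev R A sg|]]%SET|%:R
    <= 2 ^+ N * \sum_(j < J) p j.
Proof.
move=> G0 r0 u0 net Gp; elim=> [|J IH].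
  rewrite !big_ord0 mulr0 (_ : finset _ = finset.set0) ?cards0//.
  apply/finset.setP => sg; rewrite !inE; apply/negbTE/existsPn => A.
  rewrite G0 inE; apply/nandP; have [->|] := eqVneq A finset.set0; [right|by left].
  rewrite /swap_dev big1 ?normr0 ?ltxx// => n _.
  by rewrite !inE subrr mulr0.
pose near (A : {set 'I_N * bool}) := odflt finset.set0
  [pick B | (B \in G J) && ((hamming A B)%:R <= r J)].
have nearP A : A \in G J.+1 -> near A \in G J /\ (hamming A (near A))%:R <= r J.
  move=> AG; rewrite /near; case: pickP => [B /andP[]//|/= noB].
  have [B BG AB] := net J A AG.
  by have := noB B; rewrite BG AB.
rewrite !big_ord_recr/= mulrDr.
set U := \sum_(j < J) u j.
pose E1 := [set sg : {ffun 'I_N -> bool} | [exists A in G J, U < `|swap_dev R A sg|]]%SET.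
pose E := [set sg : {ffun 'I_N -> bool} |
  [exists A in G J.+1, U + u J < `|swap_dev R A sg|]]%SET.
rewrite -/E; rewrite -/U -/E1 in IH.
pose D A := [set sg : {ffun 'I_N -> bool} |
  u J < `|swap_dev R A sg - swap_dev R (near A) sg|]%SET.
have EE : (#|E| <= #|E1| + \sum_(A in G J.+1) #|D A|)%N.
  have cD : (#|\bigcup_(A in G J.+1) D A|%SET <= \sum_(A in G J.+1) #|D A|)%N.
    apply: (big_ind2 (fun (A : {set _}) m => #|A| <= m)%N) => //; first by rewrite cards0.
    move=> A m B k Am Bk; apply: leq_trans (leq_add Am Bk).
    by rewrite cardsU leq_subr.
  apply: leq_trans (_ : #|E1 :|: \bigcup_(A in G J.+1) D A|%SET <= _)%N; last first.
    by apply: leq_trans (leq_add (leqnn _) cD); rewrite cardsU leq_subr.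
  apply: subset_leq_card; apply/fintype.subsetP => sg; rewrite [in X in X -> _]inE.
  move=> /existsP[A /andP[AG Asg]]; have [nG nA] := nearP _ AG.
  have [Dsg|Dsg] := boolP (sg \in D A).
    by apply/finset.setUP; right; apply/bigcupP; exists A.
  apply/finset.setUP; left; rewrite inE; apply/existsP; exists (near A); rewrite nG/=.
  move: Dsg; rewrite inE -leNgt => Dsg.
  rewrite -(ltrD2r (u J)); apply: (lt_le_trans Asg).
  rewrite addrC -lerBlDr; apply: le_trans Dsg.
  exact: lerB_dist.
apply: (@le_trans _ _ (#|E1|%:R + \sum_(A in G J.+1) #|D A|%:R)).
  by rewrite -natr_sum -natrD ler_nat.
apply: lerD => //.
apply: (@le_trans _ _ (\sum_(A in G J.+1) 2 ^+ N * (2 * expR (- (u J ^+ 2 / (16 * r J)))))).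
  by apply: ler_sum => A /nearP[_ nA]; exact: swap_dev_incr.
rewrite sumr_const -[leLHS]mulr_natl mulrCA ler_pM2l ?exprn_gt0//.
Qed.

Lemma expR1_ge2 (R : realType) : 2 <= expR (1 : R).
Proof. by apply: le_trans (expR_ge1Dx _); lra. Qed.

Lemma sum_geometric_half (R : realFieldType) (J : nat) :
  \sum_(j < J) 2^-1 ^+ j.+1 <= 1 :> R.
Proof.
suff -> : \sum_(j < J) 2^-1 ^+ j.+1 = 1 - 2^-1 ^+ J :> R.
  by rewrite gerBl exprn_ge0.
elim: J => [|J IH]; first by rewrite big_ord0 expr0 subrr.
by rewrite big_ord_recr/= IH exprS; lra.
Qed.

Lemma sum_geometric_three_quarters (R : realFieldType) (J : nat) :
  \sum_(j < J) (3 / 4) ^+ j <= 4 :> R.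
Proof.
suff -> : \sum_(j < J) (3 / 4) ^+ j = 4 - 4 * (3 / 4) ^+ J :> R.
  by rewrite gerBl mulr_ge0// exprn_ge0// divr_ge0.
elim: J => [|J IH]; first by rewrite big_ord0 expr0 mulr1 subrr.
rewrite big_ord_recr/= IH [in RHS]exprS.
by set x := _ ^+ J; lra.
Qed.

(* [2 (32 * 16^i)^V] bounds twice the size of the net at scale [4^-i]. *)
Lemma chain_level_bound (R : realType) (V i : nat) (delta : R) :
  (0 < V)%N -> (0 < i)%N -> 0 < delta -> delta < 1 ->
  (32 / (4^-1 ^+ i) ^+ 2) ^+ V *
    (2 * expR (- (12 * (V%:R + ln delta^-1) * i%:R)))
  <= delta / 2 * 2^-1 ^+ i.
Proof.
move=> V0 i0 d0 d1.
have l0 : 0 <= ln delta^-1 by rewrite ln_ge0// invf_ge1// ltW.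
have dE : expR (- ln delta^-1) = delta.
  by rewrite expRN lnK ?invrK// posrE invr_gt0.
have i1 : 1 <= i%:R :> R by rewrite ler1n.
have V1 : 1 <= V%:R :> R by rewrite ler1n.
(* As [i >= 1], [32 * 16^i = 2^(5 + 4 i) <= 2^(9 i) <= e^(9 i)]. Of the rate 12 this leaves 3 in
   front of [i V], enough for a factor [8^(- i)]. *)
have h1 : (32 / (4^-1 ^+ i) ^+ 2) ^+ V <= expR (9 * i%:R * V%:R) :> R.
  rewrite [9 * _ * _]mulrC expRM_natl lerXn2r ?nnegrE ?expR_ge0//.
  have -> : 32 / (4^-1 ^+ i) ^+ 2 = (2 ^ (5 + 4 * i))%:R :> R.
    rewrite -exprM mulnC exprM expnD expnM natrM; congr (_ * _).
    by rewrite -exprVn !natrX -[in LHS]exprVn invrK; congr (_ ^+ _); lra.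
  apply: (@le_trans _ _ ((2 ^ (9 * i))%:R)).
    rewrite ler_nat leq_exp2l//; apply: (@leq_trans (5 * i + 4 * i)).
      by rewrite leq_add2r -[X in (X <= _)%N]muln1 leq_mul.
    by rewrite -mulnDl.
  have -> : 9 * i%:R = (9 * i)%:R * 1 :> R by rewrite natrM mulr1.
  rewrite expRM_natl natrX lerXn2r ?nnegrE ?expR_ge0//.
  exact: expR1_ge2.
apply: (le_trans (ler_wpM2r _ h1)); first by rewrite mulr_ge0// expR_ge0.
rewrite mulrCA -expRD.
apply: (@le_trans _ _ (2 * (expR (- ln delta^-1) * expR (- (3 * i)%:R)))).
  rewrite ler_pM2l// -expRD ler_expR natrM.
  set l := ln _ in l0 *; set v := V%:R in V1 *; set k := i%:R in i1 *.
  have kl : l <= l * k by rewrite ler_peMr.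
  have kv : k <= k * v by rewrite ler_peMr//; lra.
  clearbody l v k; lra.
rewrite dE mulrCA -!mulrA ler_pM2l//.
rewrite expRN -[(3 * i)%:R]mulr1 expRM_natl mulnC exprM.
have e8 : 8%:R ^+ i <= (expR 1 ^+ i) ^+ 3 :> R.
  rewrite exprAC lerXn2r ?nnegrE ?exprn_ge0 ?expR_ge0//.
  have -> : 8%:R = 2 ^+ 3 :> R by rewrite -natrX.
  by rewrite lerXn2r ?nnegrE ?expR_ge0//; exact: expR1_ge2.
apply: (@le_trans _ _ (2 * (8%:R ^+ i)^-1)).
  rewrite ler_pM2l// lef_pV2 ?posrE ?exprn_gt0 ?expR_gt0//.
have -> : 8%:R = 2 * 4 :> R by rewrite -natrM.
rewrite exprMn invfM mulrCA -exprVn mulrC ler_pM2r ?exprn_gt0//.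
case: i i0 {i1 h1 e8} => // i _.
rewrite exprS invfM; have : (4 ^+ i)^-1 <= 1 :> R.
  by rewrite invf_le1 ?exprn_gt0// exprn_ege1// ler1n.
by lra.
Qed.

Lemma swap_dev_tail (R : realType) (N V : nat) (F : {set {set 'I_N * bool}})
    (delta : R) : (0 < N)%N -> (0 < V)%N -> 0 < delta -> delta < 1 ->
  (forall S, shattered F S -> (#|S| <= V)%N) ->
  #|[set sg : {ffun 'I_N -> bool} | [exists A in F,
      16 * Num.sqrt (24 * (V%:R + ln delta^-1) * N%:R) < `|swap_dev R A sg|]]%SET|%:R
  <= 2 ^+ N * (delta / 2).
Proof.
move=> N0 V0 d0 d1 FV.
set L := V%:R + _.
have L0 : 0 < L.
  rewrite ltr_wpDr ?ltr0n// ln_ge0// invf_ge1// ltW//.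
have cT : #|{: 'I_N * bool}| = (2 * N)%N by rewrite card_prod card_ord card_bool mulnC.
pose n0 := ((2 * N)%:R : R).
have n00 : 0 < n0 by rewrite ltr0n muln_gt0.
pose r (j : nat) := n0 * 4^-1 ^+ j.
have r0 j : 0 < r j by rewrite mulr_gt0// exprn_gt0.
pose net j := sval (cid (exists_net F (r j))).
have netP j := svalP (cid (exists_net F (r j))).
pose G j := if j is 0%N then [set finset.set0]%SET else net j.
(* The powers of [3/4] sum to at most 4, while the exponent [u j ^ 2 / (16 r j) = 12 L (9/4)^j]
   stays above the [12 L (j + 1)] that the net at level [j + 1] requires. *)
pose u (j : nat) := 4 * Num.sqrt (12 * L * n0) * (3 / 4) ^+ j.
have u0 j : 0 <= u j.
  by rewrite mulr_ge0 ?exprn_ge0 ?divr_ge0// mulr_ge0// sqrtr_ge0.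
pose p (j : nat) := delta / 2 * 2^-1 ^+ j.+1.
have cover j : {in F, forall A : {set _}, exists2 B : {set _},
     B \in G j & (hamming A B)%:R <= r j}.
  case: j => [|j] A AF; last first.
    by have [_ _ /(_ (ltW (r0 _)))/(_ _ AF)] := netP j.+1.
  exists finset.set0; first by rewrite inE.
  by rewrite /r expr0 mulr1 ler_nat -cT max_card.
have GF j : {in G j.+1, forall A : {set _}, A \in F}.
  by move=> A AG; have [/fintype.subsetP + _ _] := netP j.+1; apply.
have size_net j : #|G j.+1|%:R <= (32 / (4^-1 ^+ j.+1) ^+ 2) ^+ V :> R.
  have [GjF far _] := netP j.+1.
  apply: packing_bound => //.
  - by rewrite cT muln_gt0.
  - by rewrite exprn_ile1// invf_le1// ler1n.
  - move=> S /shatteredP GS; apply: FV; apply/shatteredP => B /GS[A AG AS].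
    by exists A => //; exact: (GF j).
  - by move=> A B AG BG /(far _ _ AG BG)/ltW; rewrite /r mulrC cT.
have pbound j : #|G j.+1|%:R * (2 * expR (- (u j ^+ 2 / (16 * r j)))) <= p j.
  have e0 x : 0 <= 2 * expR x :> R by rewrite mulr_ge0// expR_ge0.
  apply: le_trans (ler_wpM2r (e0 _) (size_net j)) _.
  apply: le_trans (chain_level_bound V0 (ltn0Sn j) d0 d1).
  rewrite ler_wpM2l//.
  rewrite ler_pM2l// ler_expR lerN2 -/L.
  have -> : u j ^+ 2 / (16 * r j) = 12 * L * (9 / 4) ^+ j.
    have -> : (9 / 4) ^+ j = ((3 / 4) ^+ j) ^+ 2 / 4^-1 ^+ j :> R.
      by rewrite -exprVn invrK exprAC -exprMn; congr (_ ^+ _); field.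
    have -> : u j ^+ 2 = 16 * (12 * L * n0) * ((3 / 4) ^+ j) ^+ 2.
      rewrite /u [LHS]exprMn [X in X * _]exprMn sqr_sqrtr; last by rewrite !mulr_ge0// ltW.
      by congr (_ * _ * _); rewrite -natrX.
    rewrite /r; set x := (3 / 4) ^+ j; set y := 4^-1 ^+ j.
    have y0 : y != 0 by rewrite gt_eqF ?exprn_gt0.
    have n0' : n0 != 0 by rewrite gt_eqF.
    by clearbody x y n0; field; rewrite y0.
  rewrite ler_pM2l ?mulr_gt0//.
  elim: j {size_net} => [|j IH]; first by rewrite expr0.
  rewrite exprS -[j.+2%:R]natr1.
  have : 1 <= j.+1%:R :> R by rewrite ler1n.
  by move: IH; set x := _ ^+ j; set y := _%:R; lra.
(* At level [2 N] the radius [2 N / 4^(2 N)] is below 1, so the net contains all of [F] and the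
   chain leaves no remainder. *)
have := @chain_bound R N G r u p erefl r0 u0 _ pbound (2 * N).
move=> /(_ (fun j A AG => cover j A (GF j A AG))) H.
apply: le_trans (_ : _ <= 2 ^+ N * \sum_(j < 2 * N) p j) _; last first.
  rewrite ler_pM2l ?exprn_gt0// /p -mulr_sumr -[leRHS]mulr1 ler_pM2l ?divr_gt0//.
  exact: sum_geometric_half.
apply: le_trans H; rewrite ler_nat; apply: subset_leq_card.
apply/fintype.subsetP => sg; rewrite !inE => /existsP[A /andP[AF Asg]].
apply/existsP; exists A; apply/andP; split.
  have [B BG AB] := cover (2 * N)%N A AF.
  suff -> : A = B by [].
  have : (hamming A B)%:R < 1 :> R.
    apply: (le_lt_trans AB); rewrite /r exprVn ltr_pdivrMr ?exprn_gt0// mul1r.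
    by rewrite -natrX ltr_nat ltn_expl.
  rewrite ltrn1 ltnS leqn0 => /eqP/cards0_eq h.
  apply/finset.setP => i; apply/eqP/negPn/negP => Ai.
  by have : i \in finset.set0 by [rewrite -h inE]; rewrite inE.
apply: le_lt_trans Asg.
rewrite /u -mulr_sumr.
have -> : 24 * L * N%:R = 12 * L * n0 by rewrite /n0 natrM; ring.
have -> : 16 * Num.sqrt (12 * L * n0) = 4 * Num.sqrt (12 * L * n0) * 4 by ring.
apply: ler_wpM2l; first by rewrite mulr_ge0// sqrtr_ge0.
exact: sum_geometric_three_quarters.
Qed.

Local Open Scope classical_set_scope.
Local Open Scope ring_scope.

(** * Symmetrization and the uniform deviation bound *)

Lemma measurable_set_ltr d (T : measurableType d) (R : realType) (f g : T -> R) :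
  measurable_fun setT f -> measurable_fun setT g ->
  measurable [set x | f x < g x].
Proof.
move=> mf mg.
have := measurable_fun_ltr mf mg measurableT (Y := [set true]) I.
by rewrite setTI.
Qed.

Lemma measurable_set_ler d (T : measurableType d) (R : realType) (f g : T -> R) :
  measurable_fun setT f -> measurable_fun setT g ->
  measurable [set x | f x <= g x].
Proof.
move=> mf mg; rewrite (_ : mkset _ = ~` [set x | g x < f x]).
  by apply: measurableC; exact: measurable_set_ltr.
by apply/seteqP; split => x /=; rewrite leNgt; [move/negP|move=> ?; apply/negP].
Qed.

(** * Probabilities, integrals of bounded functions and a second moment bound *)

Lemma prob_fin d (T : measurableType d) (R : realType) (P : probability T R)
  (A : set T) : measurable A -> P A = (Pr P A)%:E.
Proof. by move=> mA; rewrite /Pr fineK// fin_num_measure. Qed.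

Lemma Pr_le d (T : measurableType d) (R : realType) (P : probability T R)
  (A B : set T) : measurable A -> measurable B -> A `<=` B -> Pr P A <= Pr P B.
Proof.
move=> mA mB AB; rewrite -lee_fin -!prob_fin//.
by apply: le_measure => //; rewrite inE.
Qed.

Lemma Pr_ge0 d (T : measurableType d) (R : realType) (P : probability T R)
  (A : set T) : 0 <= Pr P A.
Proof. by rewrite /Pr fine_ge0. Qed.

Lemma Pr_le1 d (T : measurableType d) (R : realType) (P : probability T R)
  (A : set T) : measurable A -> Pr P A <= 1.
Proof. by move=> mA; rewrite -lee_fin -prob_fin// probability_le1. Qed.

Section bounded_integrals.
Context d (T : measurableType d) (R : realType) (Q : probability T R).

Definition bounded_measurable (f : T -> R) :=
  measurable_fun setT f /\ exists M, forall x, `|f x| <= M.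

Lemma bounded_measurable_integrable f :
  bounded_measurable f -> Q.-integrable setT (EFin \o f).
Proof.
move=> [mf [M fM]]; apply: measurable_bounded_integrable => //.
  by rewrite (le_lt_trans (probability_le1 _ _)) ?ltry.
exists M; split; first exact: num_real.
by move=> y My x _; apply: le_trans (fM x) _; exact: ltW.
Qed.

Lemma bounded_measurable_cst c : bounded_measurable (fun=> c).
Proof. by split; [exact: measurable_cst|exists `|c|]. Qed.

Lemma bounded_measurable_indic A : measurable A -> bounded_measurable \1_A.
Proof.
move=> mA; split; first exact: measurable_indic.
by exists 1 => x; rewrite indicE; case: (_ \in _); rewrite ?normr1 ?normr0.
Qed.

Lemma bounded_measurableD f g : bounded_measurable f -> bounded_measurable g ->
  bounded_measurable (fun x => f x + g x).
Proof.
move=> [mf [M fM]] [mg [K gK]]; split; first exact: measurable_funD.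
by exists (M + K) => x; apply: le_trans (ler_normD _ _) _; exact: lerD.
Qed.

Lemma bounded_measurableM f g : bounded_measurable f -> bounded_measurable g ->
  bounded_measurable (fun x => f x * g x).
Proof.
move=> [mf [M fM]] [mg [K gK]]; split; first exact: measurable_funM.
by exists (M * K) => x; rewrite normrM ler_pM.
Qed.

Lemma bounded_measurable_sum (I : finType) (f : I -> T -> R) :
  (forall i, bounded_measurable (f i)) ->
  bounded_measurable (fun x => \sum_i f i x).
Proof.
move=> bf; split; first by apply: measurable_sum => i; have [] := bf i.
exists (\sum_i sval (cid (bf i).2)) => x.
apply: le_trans (ler_norm_sum _ _ _) _; apply: ler_sum => i _.
exact: (svalP (cid (bf i).2)).
Qed.

Lemma Rintegral_sum (I : finType) (f : I -> T -> R) :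
  (forall i, bounded_measurable (f i)) ->
  \int[Q]_x (\sum_i f i x) = \sum_i \int[Q]_x f i x.
Proof.
move=> bf; rewrite /Rintegral.
under eq_integral do rewrite -sumEFin.
rewrite (@integral_sum _ _ _ Q setT measurableT _ (fun i x => (f i x)%:E)).
  by rewrite -sum_fine// => i _; apply: integrable_fin_num => //; exact: bounded_measurable_integrable.
by move=> i; exact: bounded_measurable_integrable.
Qed.

Lemma Rintegral_indic A : measurable A -> \int[Q]_x \1_A x = Pr Q A.
Proof. by move=> mA; rewrite /Rintegral integral_indic// setIT. Qed.

Lemma bounded_le_Rintegral f g : bounded_measurable f -> bounded_measurable g ->
  (forall x, f x <= g x) -> \int[Q]_x f x <= \int[Q]_x g x.
Proof.
by move=> bf bg fg; apply: le_Rintegral => //; exact: bounded_measurable_integrable.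
Qed.

Lemma Pr_markov f A (a : R) : bounded_measurable f -> measurable A ->
  (forall x, 0 <= f x) -> (forall x, A x -> a <= f x) ->
  a * Pr Q A <= \int[Q]_x f x.
Proof.
move=> bf mA f0 Af.
rewrite -Rintegral_indic// -RintegralZl//; last first.
  exact/bounded_measurable_integrable/bounded_measurable_indic.
apply: bounded_le_Rintegral => //.
  by apply: bounded_measurableM; [exact: bounded_measurable_cst|exact: bounded_measurable_indic].
move=> x; rewrite indicE; have [xA|xA] := boolP (x \in A); rewrite ?mulr1 ?mulr0//.
by apply: Af; rewrite inE in xA.
Qed.

End bounded_integrals.

(** Chebyshev's inequality: the off-diagonal covariances vanish, so the sum has variance at most
    [N / 4], and [1 <= 2 N eps^2] brings [1 / (4 N eps^2)] down to one half. *)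
Lemma pairwise_independent_frequency d (T : measurableType d) (R : realType)
    (Q : probability T R) (N : nat) (E : 'I_N -> set T) (p eps : R) :
  (0 < N)%N -> 0 < eps -> 1 <= 2 * N%:R * eps ^+ 2 ->
  (forall n, measurable (E n)) -> (forall n, Pr Q (E n) = p) ->
  (forall n m, n != m -> Pr Q (E n `&` E m) = p * p) ->
  Pr Q [set x | eps < `|average (fun n => \1_(E n) x) - p|] <= 2^-1.
Proof.
move=> N0 e0 Ne mE Ep Epp.
have [N0' Nn0] : 0 < N%:R :> R /\ N%:R != 0 :> R by rewrite ltr0n pnatr_eq0 -lt0n N0.
have p0 : 0 <= p by rewrite -(Ep (Ordinal N0)) Pr_ge0.
pose f n x : R := \1_(E n) x - p.
have bE n : bounded_measurable (\1_(E n) : T -> R) by exact: bounded_measurable_indic.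
have bf n : bounded_measurable (f n).
  by apply: bounded_measurableD (bE n) _; exact: bounded_measurable_cst.
have iE (g : T -> R) := @bounded_measurable_integrable _ _ _ Q g.
have bI n m : bounded_measurable (\1_(E n `&` E m) : T -> R).
  by apply: bounded_measurable_indic; exact: measurableI.
have bc (c : R) : bounded_measurable (fun _ : T => c) by exact: bounded_measurable_cst.
have cov n m : \int[Q]_x (f n x * f m x) = Pr Q (E n `&` E m) - p * p.
  transitivity (\int[Q]_x ((\1_(E n `&` E m) x + (- p) * \1_(E n) x) +
     ((- p) * \1_(E m) x + p * p) : R)).
    apply: eq_Rintegral => x _; rewrite /f indicI/=; ring.
  rewrite !RintegralD ?RintegralZl ?Rintegral_cst ?Rintegral_indic//;
    try by apply: iE; do ?[exact: bE | exact: bI | exact: bc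
       | apply: bounded_measurableD | apply: bounded_measurableM].
    by rewrite !Ep (_ : fine (Q setT) = 1) ?probability_setT//; ring.
  exact: measurableI.
pose g x : R := \sum_n f n x.
have bg : bounded_measurable g by exact: bounded_measurable_sum.
have var : \int[Q]_x (g x * g x) <= N%:R * p * (1 - p).
  rewrite (_ : \int[Q]_x _ = \int[Q]_x (\sum_(i : 'I_N * 'I_N) f i.1 x * f i.2 x)); last first.
    apply: eq_Rintegral => x _; rewrite /g mulr_suml -(pair_bigA _ (fun n m => f n x * f m x))/=.
    by apply: eq_bigr => n _; rewrite mulr_sumr.
  rewrite Rintegral_sum => [|[n m]]; last exact: bounded_measurableM.
  rewrite -(pair_bigA _ (fun n m => \int[Q]_x (f n x * f m x)))/=.
  rewrite -mulrA mulr_natl -[X in _ *+ X]card_ord -sumr_const; apply: ler_sum => n _.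
  rewrite (bigD1 n)//= big1 => [|m mn].
    by rewrite cov setIid Ep addr0 mulrBr mulr1.
  by rewrite cov Epp 1?eq_sym// subrr.
have p1 : p <= 1 by rewrite -(Ep (Ordinal N0)) Pr_le1.
set A := mkset _.
have mA : measurable A.
  apply: measurable_set_ltr => //; apply: measurableT_comp => //.
  apply: measurable_funB => //; apply: measurable_funM => //.
  by apply: measurable_sum => n; exact: measurable_indic.
have gE x : average (fun n => \1_(E n) x) - p = N%:R^-1 * g x.
  rewrite /average /g sumrB sumr_const card_ord mulrBr; congr (_ - _).
  by rewrite -[p *+ N]mulr_natl mulrA mulVf// mul1r.
have := @Pr_markov _ _ _ Q (fun x => g x * g x) A ((N%:R * eps) ^+ 2)
  (bounded_measurableM bg bg) mA (fun x => sqr_ge0 (g x)).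
move=> /(_ _)/le_trans/(_ var) H.
have {H} : (N%:R * eps) ^+ 2 * Pr Q A <= N%:R * p * (1 - p).
  apply: H => x; rewrite /A/= gE normrM gtr0_norm ?invr_gt0// ltr_pdivlMl// => h.
  rewrite -expr2 -(real_normK (num_real (g x))) lerXn2r ?nnegrE// ?(ltW h)//.
  by rewrite mulr_ge0// ltW.
have pp : p * (1 - p) <= 4^-1 by have := sqr_ge0 (p - 2^-1); nra.
move=> H; have PA0 := Pr_ge0 Q A.
have {}H : N%:R * eps ^+ 2 * Pr Q A <= 4^-1.
  apply: le_trans pp; rewrite -(ler_pM2l N0') [leRHS]mulrA; apply: le_trans H.
  by rewrite exprMn expr2 !mulrA.
move: Ne; set y := N%:R * eps ^+ 2 in H *; rewrite -mulrA -/y => Ne.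
have : 2^-1 * Pr Q A <= y * Pr Q A by rewrite ler_wpM2r//; lra.
by lra.
Qed.

(** Boxes are a generating pi-system, so this makes [Q] the product law of [N] copies of [D], with
    no reference to the space on which the sample lives. *)
Definition iid_law d (Z : measurableType d) (R : realType) (N : nat)
    (D : probability Z R) (Q : probability (N.-tuple Z) R) :=
  forall A : 'I_N -> set Z, (forall n, measurable (A n)) ->
    Pr Q [set t | forall n, A n (tnth t n)] = \prod_n Pr D (A n).

Definition swap_tuples (Z : Type) (N : nat) (sg : {ffun 'I_N -> bool})
    (p : N.-tuple Z * N.-tuple Z) : N.-tuple Z * N.-tuple Z :=
  ([tuple tnth (if sg n then p.2 else p.1) n | n < N],
   [tuple tnth (if sg n then p.1 else p.2) n | n < N]).

Lemma measurable_set_exists d (T : measurableType d) (I : countType)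
    (F : I -> set T) : (forall i, measurable (F i)) ->
  measurable [set x | exists i, F i x].
Proof.
move=> mF; rewrite (_ : mkset _ = \bigcup_i F i).
  by apply: countable_bigcupT_measurable => //; exact: countableP.
by apply/seteqP; split => x [i]; [exists i|move=> _; exists i].
Qed.

Lemma measurable_set_forall d (T : measurableType d) (I : countType)
    (F : I -> set T) : (forall i, measurable (F i)) ->
  measurable [set x | forall i, F i x].
Proof.
move=> mF; rewrite (_ : mkset _ = ~` [set x | exists i, (~` F i) x]).
  by apply: measurableC; apply: measurable_set_exists => i; exact: measurableC.
apply/seteqP; split => x /= h; first by move=> [i]; apply.
by move=> i; apply: contrapT => ?; apply: h; exists i.
Qed.

Lemma measurable_tuple_box d (Z : measurableType d) (N : nat) (A : 'I_N -> set Z) :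
  (forall n, measurable (A n)) ->
  measurable [set t : N.-tuple Z | forall n, A n (tnth t n)].
Proof.
move=> mA; apply: measurable_set_forall => n.
by have := measurable_tnth n measurableT (mA n); rewrite setTI.
Qed.

(** * Exchangeability of a sample and its ghost *)

Section swap_invariance.
Context d (Z : measurableType d) (R : realType) (N : nat).
Let TT := (N.-tuple Z * N.-tuple Z)%type.

Let box (A : 'I_N -> bool -> set Z) : set TT :=
  [set p | forall n, A n false (tnth p.1 n) /\ A n true (tnth p.2 n)].

Let boxes : set (set TT) :=
  [set X | exists2 A, (forall n b, measurable (A n b)) & X = box A].

Let boxE A : box A = [set t | forall n, A n false (tnth t n)] `*`
  [set t | forall n, A n true (tnth t n)].
Proof.
apply/seteqP; split => [[t t']/= h|[t t']/= [h1 h2] n]; last by split.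
by split => n; have [] := h n.
Qed.

Let boxes_measurable : boxes `<=` measurable.
Proof.
move=> _ [A mA ->]; rewrite boxE; apply: measurableX;
  [exact: (measurable_tuple_box (mA ^~ false))|exact: (measurable_tuple_box (mA ^~ true))].
Qed.

Let measurable_boxes (X : set TT) : measurable X -> <<s boxes >> X.
Proof.
move=> mX.
pose GT := g_sigma_algebraType boxes.
suff mid : measurable_fun [set: GT] (fun x : GT => (x.1 : N.-tuple Z, x.2 : N.-tuple Z)).
  have := mid measurableT _ mX; rewrite setTI.
  by rewrite (_ : _ @^-1` X = X)//; apply/seteqP; split => -[].
apply: measurable_fun_pair; apply/measurable_fun_tnthP => i _ A mA; rewrite setTI.
  apply: sub_sigma_algebra.
  exists (fun n b => if (n == i) && ~~ b then A else setT) => [n b|]; first by case: ifP.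
  apply/seteqP; split => [[t t']/= h n|[t t']/= /(_ i)]; rewrite ?eqxx/=; last by case.
  by split; rewrite ?andbT ?andbF//; case: eqP => // ->.
apply: sub_sigma_algebra.
exists (fun n b => if (n == i) && b then A else setT) => [n b|]; first by case: ifP.
apply/seteqP; split => [[t t']/= h n|[t t']/= /(_ i)]; rewrite ?eqxx/=; last by case.
by split; rewrite ?andbT ?andbF//; case: eqP => // ->.
Qed.

Lemma measurable_swap_tuples (sg : {ffun 'I_N -> bool}) :
  measurable_fun [set: TT] (@swap_tuples Z N sg).
Proof.
have mt (b : bool) : measurable_fun [set: TT] (fun p => if b then p.2 else p.1).
  by case: b; [exact: measurable_snd|exact: measurable_fst].
apply: measurable_fun_pair; apply/measurable_fun_tnthP => i.
  rewrite (_ : _ \o _ = (fun t => tnth t i) \o (fun p : TT => if sg i then p.2 else p.1)).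
    by apply: measurableT_comp; [exact: measurable_tnth|exact: mt].
  by apply/funext => p /=; rewrite tnth_mktuple.
rewrite (_ : _ \o _ = (fun t => tnth t i) \o (fun p : TT => if ~~ sg i then p.2 else p.1)).
  by apply: measurableT_comp; [exact: measurable_tnth|exact: mt].
by apply/funext => p /=; rewrite tnth_mktuple if_neg.
Qed.

(** Two finite measures agreeing on boxes are equal, and on a box a swap only exchanges the factors
    [Pr D (A n false)] and [Pr D (A n true)]. *)
Lemma swap_tuples_invariant (D : probability Z R) (Q : probability (N.-tuple Z) R)
    (sg : {ffun 'I_N -> bool}) (X : set TT) : iid_law D Q -> measurable X ->
  (Q \x Q)%E (@swap_tuples Z N sg @^-1` X) = (Q \x Q)%E X.
Proof.
move=> QD mX.
pose mu : {measure set TT -> \bar R} :=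
  pushforward (Q \x Q)%E (@swap_tuples Z N sg).
change (mu (measurable_swap_tuples sg) X = (Q \x Q)%E X).
have QQ (A : 'I_N -> bool -> set Z) : (forall n b, measurable (A n b)) ->
    (Q \x Q)%E (box A) = (\prod_n (Pr D (A n false) * Pr D (A n true)))%:E.
  move=> mA; have m1 := measurable_tuple_box (mA ^~ false).
  have m2 := measurable_tuple_box (mA ^~ true).
  rewrite boxE product_measure1E//.
  rewrite [X in (X * _)%E](prob_fin Q m1) [X in (_ * X)%E](prob_fin Q m2).
  by rewrite (QD (A ^~ false))// (QD (A ^~ true))// -EFinM big_split.
apply: (g_sigma_algebra_measure_unique boxes boxes_measurable (fun=> setT)) => //.
- move=> _; exists (fun _ _ => setT) => //.
  by apply/seteqP; split.
- by rewrite bigcup_const//; exists 0%N.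
- move=> _ _ [A mA ->] [B mB ->]; exists (fun n b => A n b `&` B n b).
    by move=> n b; exact: measurableI.
  apply/seteqP; split => [[t t']/= [h1 h2] n|[t t']/= h].
    by have [? ?] := h1 n; have [? ?] := h2 n.
  by split => n; have [[? ?] [? ?]] := h n.
- move=> _ [A mA ->].
  pose A' n b := A n (b (+) sg n).
  rewrite [LHS](_ : _ = (Q \x Q)%E (box A')).
    apply: (etrans (QQ A' (fun n b => mA n (b (+) sg n)))).
    apply/esym; apply: (etrans (QQ A mA)); congr EFin; apply: eq_bigr => n _.
    by rewrite /A'; case: (sg n); rewrite //= mulrC.
  congr ((Q \x Q)%E _); rewrite /A'; apply/seteqP.
  split => -[t t']/= h n; have := h n; rewrite ?tnth_mktuple;
    by case: (sg n) => /= -[? ?]; split.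
- move=> _; apply: (le_lt_trans (probability_le1 (Q \x Q)%E measurableT)).
  exact: ltry.
- exact: measurable_boxes.
Qed.

End swap_invariance.

Definition frequency (Z : Type) (R : realType) (N : nat) (A : set Z)
    (t : N.-tuple Z) : R :=
  average (fun n : 'I_N => \1_A (tnth t n)).

Definition traces (Z I : Type) (J : finType) (pts : J -> Z) (B : I -> set Z) :
    {set {set J}} :=
  [set A | `[< exists i, A = [set j | pts j \in B i]%SET >]]%SET.

(** [pts] may repeat points, as the [2 N] points of a double sample may coincide. *)
Definition vc_dim_le (Z I : Type) (V : nat) (B : I -> set Z) :=
  forall (J : finType) (pts : J -> Z) (S : {set J}),
    shattered (traces pts B) S -> (#|S| <= V)%N.

Lemma measurable_frequency d (Z : measurableType d) (R : realType) (N : nat)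
    (A : set Z) : measurable A ->
  measurable_fun setT (@frequency Z R N A).
Proof.
move=> mA; apply: measurable_funM => //; apply: measurable_sum => n.
by apply: measurableT_comp; [exact: measurable_indic|exact: measurable_tnth].
Qed.

Lemma PrT d (T : measurableType d) (R : realType) (P : probability T R) :
  Pr P setT = 1.
Proof. by rewrite /Pr probability_setT. Qed.

Lemma PrC d (T : measurableType d) (R : realType) (P : probability T R) (A : set T) :
  measurable A -> Pr P (~` A) = 1 - Pr P A.
Proof. by move=> mA; rewrite /Pr probability_setC// fineB// ?fin_num_measure. Qed.

Lemma frequency_concentration d (Z : measurableType d) (R : realType) (N : nat)
    (D : probability Z R) (Q : probability (N.-tuple Z) R) (A : set Z) (eps : R) :
  iid_law D Q -> (0 < N)%N -> 0 < eps -> 1 <= 2 * N%:R * eps ^+ 2 -> measurable A ->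
  Pr Q [set t | eps < `|frequency R A t - Pr D A|] <= 2^-1.
Proof.
move=> QD N0 e0 Ne mA.
pose E (n : 'I_N) := [set t : N.-tuple Z | A (tnth t n)].
have mE n : measurable (E n).
  by have := measurable_tnth n measurableT mA; rewrite setTI.
(* Sides [A] on [S] and full elsewhere: one-element [S] gives the marginals, two-element [S]
   pairwise independence. *)
have PE (S : pred 'I_N) :
    Pr Q [set t | forall n, (if S n then A else setT) (tnth t n)] = \prod_(n | S n) Pr D A.
  rewrite (QD (fun n => if S n then A else setT)) => [|n]; last by case: ifP.
  by rewrite [RHS]big_mkcond; apply: eq_bigr => n _; case: ifP => // _; rewrite PrT.
rewrite (_ : mkset _ = [set t | eps < `|average (fun n => \1_(E n) t) - Pr D A|]); last first.
  apply/seteqP; split => t /=; rewrite /frequency (_ : average _ = average (fun n => \1_(E n) t))//;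
    congr (_ * _); apply: eq_bigr => n _; rewrite !indicE; congr (_%:R);
    by apply/idP/idP; rewrite !inE.
apply: pairwise_independent_frequency => //.
  move=> n; have := PE (pred1 n); rewrite big_pred1_eq => <-; congr Pr.
  apply/seteqP; split => [t /= tn m|t /= /(_ n)]; last by rewrite eqxx.
  by case: eqP => // ->.
move=> n m nm; have := PE (pred2 n m).
rewrite (eq_bigl (fun i => i \in pred2 n m))// prodr_const card2 nm expr2 => <-.
congr Pr; apply/seteqP; split => [t /= [tn tm] i|t /= h].
  by case: eqP => [->//|_]; case: eqP => [->//|_].
by split; [have := h n|have := h m]; rewrite !eqxx ?orbT.
Qed.

(** The sum is the mean number of events that occur. This turns a count of sign vectors at each
    fixed double sample into a bound on probabilities. *)
Lemma sum_Pr_le (I : finType) d (T : measurableType d) (R : realType)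
    (P : probability T R) (E : I -> set T) (c : R) :
  (forall i, measurable (E i)) ->
  (forall x, #|[set i | x \in E i]%SET|%:R <= c) -> \sum_i Pr P (E i) <= c.
Proof.
move=> mE Ec.
have bE i : bounded_measurable (\1_(E i) : T -> R) by exact: bounded_measurable_indic.
under eq_bigr do rewrite -Rintegral_indic//.
rewrite -Rintegral_sum//.
have -> : c = \int[P]_x c by rewrite Rintegral_cst// -/(Pr P setT) PrT mulr1.
apply: bounded_le_Rintegral.
- exact: bounded_measurable_sum.
- exact: bounded_measurable_cst.
- move=> x; apply: le_trans (Ec x); rewrite -sum1_card natr_sum [leRHS]big_mkcond/=.
  by apply: ler_sum => i _; rewrite indicE inE; case: ifP.
Qed.

(* A fresh sample stays within [eps] of the mean with probability 1/2, so a
   deviation of [2 eps] is seen as a deviation of [eps] between two samples. *)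
Lemma symmetrization d (Z : measurableType d) (R : realType) (N : nat)
    (D : probability Z R) (Q : probability (N.-tuple Z) R) (I : countType)
    (B : I -> set Z) (eps : R) :
  iid_law D Q -> (0 < N)%N -> 0 < eps -> 1 <= 2 * N%:R * eps ^+ 2 ->
  (forall i, measurable (B i)) ->
  Pr Q [set t | exists i, 2 * eps < `|frequency R (B i) t - Pr D (B i)|] <=
  2 * Pr (Q \x Q)%E [set p | exists i,
                   eps < `|frequency R (B i) p.1 - frequency R (B i) p.2|].
Proof.
move=> QD N0 e0 Ne mB.
set Bad := mkset _; set E := mkset _.
have mfr i : measurable_fun setT (@frequency Z R N (B i)) by exact: measurable_frequency.
have mBad : measurable Bad.
  apply: measurable_set_exists => i; apply: measurable_set_ltr => //.
  by apply: measurableT_comp => //; exact: measurable_funB.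
have mE : measurable E.
  apply: measurable_set_exists => i; apply: measurable_set_ltr => //.
  apply: measurableT_comp => //; apply: measurable_funB.
    by apply: measurableT_comp => //; exact: measurable_fst.
  by apply: measurableT_comp => //; exact: measurable_snd.
rewrite -ler_pdivrMl// -Rintegral_indic//.
rewrite -RintegralZl//; last exact/bounded_measurable_integrable/bounded_measurable_indic.
rewrite /Pr/=; apply: fine_le.
- apply: integrable_fin_num => //; apply: bounded_measurable_integrable.
  by apply: bounded_measurableM; [exact: bounded_measurable_cst|exact: bounded_measurable_indic].
- exact: (fin_num_measure ((Q \x Q)%E : probability _ R) E mE).
apply: ge0_le_integral => //.
- by apply/measurable_EFinP; apply: measurable_funM => //; exact: measurable_indic.
- exact: measurable_fun_xsection.
move=> t _ /=; rewrite indicE.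
have [tB|_] := boolP (t \in Bad); last by rewrite mulr0.
rewrite mulr1.
have mX : measurable (xsection E t) by exact: measurable_xsection.
rewrite (prob_fin Q mX) lee_fin.
move: tB; rewrite inE => -[i ti].
have mC : measurable [set t' : N.-tuple Z | eps < `|frequency R (B i) t' - Pr D (B i)|].
  apply: measurable_set_ltr => //; apply: measurableT_comp => //.
  exact: measurable_funB.
apply: le_trans (_ : Pr Q (~` [set t' : N.-tuple Z | eps < `|frequency R (B i) t' - Pr D (B i)|]) <= _).
  rewrite PrC//.
  have := frequency_concentration QD N0 e0 Ne (mB i).
  by lra.
apply: Pr_le => //; first exact: measurableC.
move=> t' /= /negP; rewrite -leNgt => t't; rewrite /xsection/= inE; exists i => /=.
have := ler_distD (frequency R (B i) t') (frequency R (B i) t) (Pr D (B i)).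
by lra.
Qed.

(** All [2 ^ N] swapped events have the probability of the original one, and at each fixed double
    sample at most a fraction [delta / 2] of the swaps is bad. Symmetrization doubles both
    [delta / 2] and the threshold [16 sqrt (24 L / N)]. *)
Lemma vc_deviation d (Z : measurableType d) (R : realType) (N V : nat)
    (D : probability Z R) (Q : probability (N.-tuple Z) R) (I : countType)
    (B : I -> set Z) (delta : R) :
  iid_law D Q -> (0 < N)%N -> (0 < V)%N -> 0 < delta -> delta < 1 ->
  (forall i, measurable (B i)) -> vc_dim_le V B ->
  Pr Q [set t | exists i, 32 * Num.sqrt (24 * (V%:R + ln delta^-1) / N%:R) <
                  `|frequency R (B i) t - Pr D (B i)|] <= delta.
Proof.
move=> QD N0 V0 d0 d1 mB BV.
set L := V%:R + _.
have L1 : 1 <= L.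
  by rewrite -[1]addr0 lerD// ?ler1n// ln_ge0// invf_ge1// ltW.
have N0' : 0 < N%:R :> R by rewrite ltr0n.
pose eps := 16 * Num.sqrt (24 * L / N%:R).
have -> : 32 * Num.sqrt (24 * L / N%:R) = 2 * eps by rewrite /eps; ring.
have LN0 : 0 < 24 * L / N%:R by rewrite divr_gt0// mulr_gt0//; lra.
have e0 : 0 < eps by rewrite mulr_gt0// sqrtr_gt0.
have Ne : 1 <= 2 * N%:R * eps ^+ 2.
  rewrite /eps exprMn sqr_sqrtr ?ltW//.
  rewrite (_ : 2 * _ * _ = 12288 * L); first by lra.
  by field; rewrite gt_eqF.
apply: le_trans (symmetrization QD N0 e0 Ne mB) _.
set E := mkset _.
have mfr i : measurable_fun setT (@frequency Z R N (B i)) by exact: measurable_frequency.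
have mE : measurable E.
  apply: measurable_set_exists => i; apply: measurable_set_ltr => //.
  apply: measurableT_comp => //; apply: measurable_funB.
    by apply: measurableT_comp => //; exact: measurable_fst.
  by apply: measurableT_comp => //; exact: measurable_snd.
pose Esw (sg : {ffun 'I_N -> bool}) := @swap_tuples Z N sg @^-1` E.
have mEsw sg : measurable (Esw sg).
  by have := @measurable_swap_tuples _ Z N sg measurableT _ mE; rewrite setTI.
have : \sum_(sg : {ffun 'I_N -> bool}) Pr (Q \x Q)%E (Esw sg) <= 2 ^+ N * (delta / 2).
  apply: sum_Pr_le => // p.
  pose pts (x : 'I_N * bool) := tnth (if x.2 then p.2 else p.1) x.1.
  have := swap_dev_tail N0 V0 d0 d1 (BV _ pts).
  apply: le_trans; rewrite ler_nat; apply: subset_leq_card.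
  apply/fintype.subsetP => sg; rewrite !inE => -[i].
  set A := [set x | pts x \in B i]%SET.
  have -> : frequency R (B i) (swap_tuples sg p).1 - frequency R (B i) (swap_tuples sg p).2
      = N%:R^-1 * swap_dev R A sg.
    rewrite /frequency /average -mulrBr; congr (_ * _); rewrite -sumrB /swap_dev.
    apply: eq_bigr => n _; rewrite !tnth_mktuple !indicE !inE /pts/=.
    by case: (sg n); rewrite ?expr0 ?expr1 ?mul1r// mulN1r opprB.
  rewrite normrM gtr0_norm ?invr_gt0// ltr_pdivlMl// => h.
  apply/existsP; exists A; apply/andP; split.
    by rewrite inE; apply/asboolP; exists i.
  apply: le_lt_trans h; rewrite -/L /eps.
  have -> : 24 * L * N%:R = N%:R ^+ 2 * (24 * L / N%:R) by field; rewrite gt_eqF.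
  by rewrite sqrtrM ?sqr_ge0// sqrtr_sqr gtr0_norm// mulrCA.
have EswE sg : Pr (Q \x Q)%E (Esw sg) = Pr (Q \x Q)%E E.
  exact: (congr1 fine (swap_tuples_invariant sg QD mE)).
under eq_bigr do rewrite EswE.
rewrite sumr_const card_ffun card_bool card_ord -[X in X <= _ -> _]mulr_natl natrX ler_pM2l ?exprn_gt0//.
by rewrite ler_pdivlMr// mulrC.
Qed.

(** * Projected half-spaces *)

(** More than [V] vectors satisfy a linear relation [v] with some positive coefficient. If a
    half-space picked exactly the indices with [v k <= 0], each product of [v k] with the value at
    [k] would be nonnegative and one positive, yet they sum to zero. *)
Lemma vc_halfspaces (R : realFieldType) (Z I : Type) (V : nat)
    (phi : Z -> 'rV[R]_V) (a : I -> 'cV[R]_V) :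
  vc_dim_le V (fun i => [set z | (phi z *m a i) 0 0 <= 0]).
Proof.
move=> J pts S /shatteredP sS; rewrite leqNgt; apply/negP => VS.
pose Phi : 'M[R]_(#|S|, V) := \matrix_(i, j) phi (pts (enum_val i)) 0 j.
have rowPhi i : row i Phi = phi (pts (enum_val i)).
  by apply/rowP => j; rewrite !mxE.
have : kermx Phi != 0.
  rewrite -mxrank_eq0 mxrank_ker subn_eq0 -ltnNge.
  exact: leq_ltn_trans (rank_leq_col _) VS.
case/rowV0Pn => v0 /sub_kermxP v0Phi v00.
have [v [vPhi [i vi]]] : exists v : 'rV[R]_#|S|, v *m Phi = 0 /\ exists i, 0 < v 0 i.
  have [i vi] : exists i, v0 0 i != 0.
    apply: contrapT => h; move/eqP: v00; apply; apply/rowP => i; rewrite mxE.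
    by apply/eqP/negPn/negP => vi; apply: h; exists i.
  have [vi0|vi0] := ltP 0 (v0 0 i); first by exists v0; split=> //; exists i.
  exists (- v0); split; first by rewrite mulNmx v0Phi oppr0.
  by exists i; rewrite mxE oppr_gt0 lt_neqAle vi.
pose B := [set enum_val i | i : 'I_#|S| & v 0 i <= 0]%SET.
have BS : B \subset S.
  by apply/fintype.subsetP => _ /imsetP[k _ ->]; exact: enum_valP.
have [A] := sS B BS; rewrite inE => /asboolP[l ->] /finset.setP AB.
have sgn k : (phi (pts (enum_val k)) *m a l) 0 0 <= 0 <-> v 0 k <= 0.
  have := AB (enum_val k); rewrite !inE enum_valP andbT => ABk.
  split=> [h|h].
    have : enum_val k \in B by rewrite -ABk; apply/mem_set.
    by move=> /imsetP[k' + /enum_val_inj ->]; rewrite inE.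
  have : enum_val k \in B by apply/imsetP; exists k; rewrite ?inE.
  by rewrite -ABk => /set_mem.
have : (v *m Phi *m a l) 0 0 = 0 by rewrite vPhi mul0mx mxE.
rewrite -mulmxA mxE.
have E k : (Phi *m a l) k 0 = (phi (pts (enum_val k)) *m a l) 0 0.
  by rewrite -rowPhi -row_mul [RHS]mxE.
under eq_bigr do rewrite E.
rewrite (bigD1 i)//=; apply/eqP; rewrite gt_eqF//.
have pos k : 0 < v 0 k -> 0 < (phi (pts (enum_val k)) *m a l) 0 0.
  by rewrite !ltNge => /negP vk; apply/negP => /sgn.
apply: ltr_wpDr; last by rewrite mulr_gt0// pos.
apply: sumr_ge0 => k _; have [vk|vk] := leP (v 0 k) 0.
  by apply: mulr_le0 => //; apply/sgn.
by rewrite mulr_ge0// ltW// pos.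
Qed.

Section measurable_matrix.
Context d (T : measurableType d) (R : realType).

Lemma measurable_entry (m n : nat) (i : 'I_m) (j : 'I_n) :
  measurable_fun setT (fun A : 'M[R]_(m, n) => A i j).
Proof.
move=> _ Y mY; rewrite setTI; apply: sub_sigma_algebra.
by exists i, j; exists Y.
Qed.

Lemma measurable_mulmx_entry (m n p : nat) (A : T -> 'M[R]_(m, n)) (B : T -> 'M[R]_(n, p))
    i j : (forall i j, measurable_fun setT (fun x => A x i j)) ->
  (forall i j, measurable_fun setT (fun x => B x i j)) ->
  measurable_fun setT (fun x => (A x *m B x) i j).
Proof.
move=> mA mB.
rewrite (_ : (fun x => _) = (fun x => \sum_l A x i l * B x l j)).
  by apply: measurable_sum => l; exact: measurable_funM.
by apply/funext => x; rewrite mxE.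
Qed.

Lemma measurable_dot (n : nat) (u v : T -> 'cV[R]_n) :
  (forall i j, measurable_fun setT (fun x => u x i j)) ->
  (forall i j, measurable_fun setT (fun x => v x i j)) ->
  measurable_fun setT (fun x => dot (u x) (v x)).
Proof.
move=> mu mv; apply: measurable_mulmx_entry => // i j.
by rewrite (_ : (fun x => _) = (fun x => u x j i))//; apply/funext => x; rewrite mxE.
Qed.

End measurable_matrix.

Definition projected_set (R : realType) (k d : nat) (M : 'M[R]_(k, d))
    (q : 'cV[R]_k * R * R) : set ('cV[R]_d * R) :=
  [set z | (dot q.1.1 (M *m z.1) + q.1.2) * z.2 <= q.2].

Lemma vc_projected_set (R : realType) (k d : nat) (M : 'M[R]_(k, d)) (I : Type)
    (q : I -> 'cV[R]_k * R * R) :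
  vc_dim_le (k + 2) (fun i => projected_set M (q i)).
Proof.
(* [(y M x, y, -1)] paired with [(g, b, c)] gives [(g . M x + b) y - c]; the threshold [c] accounts
   for the last dimension. *)
pose phi (z : 'cV[R]_d * R) : 'rV[R]_(k + (1 + 1)) :=
  row_mx (z.2 *: (M *m z.1)^T) (row_mx z.2%:M (- 1)%:M).
pose a i : 'cV[R]_(k + (1 + 1)) := col_mx (q i).1.1 (col_mx (q i).1.2%:M (q i).2%:M).
have := @vc_halfspaces R _ I _ phi a; congr vc_dim_le.
apply/funext => i; apply/seteqP.
suff h z : (phi z *m a i) 0 0 = (dot (q i).1.1 (M *m z.1) + (q i).1.2) * z.2 - (q i).2.
  by split => z; rewrite /projected_set/= h subr_le0.
have dotE : (z.2 *: (M *m z.1)^T *m (q i).1.1) 0 0 = z.2 * dot (q i).1.1 (M *m z.1).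
  rewrite -scalemxAl mxE; congr (_ * _).
  by rewrite /dot -[LHS]trace_mx11 -mxtrace_tr trmx_mul trmxK trace_mx11.
rewrite /phi /a !mul_row_col [LHS]mxE dotE [X in _ + X]mxE -!scalar_mxM.
rewrite [X in _ + (X + _)]mxE [X in _ + (_ + X)]mxE !eqxx !mulr1n; ring.
Qed.

Definition ratr_params (R : realType) (k : nat) (q : 'cV[rat]_k * rat * rat) :
    'cV[R]_k * R * R :=
  (map_mx ratr q.1.1, ratr q.1.2, ratr q.2).

Lemma exists_ratr_near (R : realType) (x e : R) : 0 < e ->
  exists q : rat, `|ratr q - x| <= e.
Proof.
move=> e0; have [|q] := @rat_in_itvoo R (x - e) (x + e); first by lra.
rewrite in_itv/= => /andP[h1 h2].
by exists q; rewrite ler_norml; apply/andP; split; lra.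
Qed.

Lemma frequency_le (Z : Type) (R : realType) (N : nat) (A B : set Z)
    (t : N.-tuple Z) : (forall n, A (tnth t n) -> B (tnth t n)) ->
  frequency R A t <= frequency R B t.
Proof.
move=> AB; rewrite /frequency /average ler_wpM2l ?invr_ge0//.
apply: ler_sum => n _; rewrite !indicE ler_nat.
have [/set_mem/AB/mem_set -> //|//] := boolP (tnth t n \in A).
Qed.

Section projected_set_approximation.
Context (R : realType) (k d N : nat) (M : 'M[R]_(k, d)).
Let Z := ('cV[R]_d * R)%type.

Let margin (g : 'cV[R]_k) (b : R) (z : Z) : R := (dot g (M *m z.1) + b) * z.2.

(** A Lipschitz constant of the margin at [z] in [(g, b)], for the sup norm. *)
Let size_ (z : Z) : R := (\sum_j `|(M *m z.1) j 0| + 1) * `|z.2|.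

Let margin_near (g : 'cV[R]_k) (b : R) (g' : 'cV[R]_k) (b' : R) z e :
  (forall j, `|g' j 0 - g j 0| <= e) ->
  `|b' - b| <= e -> `|margin g' b' z - margin g b z| <= e * size_ z.
Proof.
move=> gg' bb'.
rewrite /margin /size_ -mulrBl normrM mulrA ler_wpM2r//.
have -> : dot g' (M *m z.1) + b' - (dot g (M *m z.1) + b) =
    \sum_j (g' j 0 - g j 0) * (M *m z.1) j 0 + (b' - b).
  have dotE (u v : 'cV[R]_k) : dot u v = \sum_j u j 0 * v j 0.
    by rewrite /dot mxE; apply: eq_bigr => j _; rewrite mxE.
  rewrite !dotE opprD addrACA; congr (_ + _).
  by rewrite -sumrB; apply: eq_bigr => j _; rewrite -mulrBl.
rewrite mulrDr mulr1; apply: le_trans (ler_normD _ _) _; apply: lerD => //.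
apply: le_trans (ler_norm_sum _ _ _) _; rewrite mulr_sumr; apply: ler_sum => j _.
by rewrite normrM ler_wpM2r.
Qed.

Let measurable_entryM j : measurable_fun setT (fun z : Z => (M *m z.1) j 0).
Proof.
apply: measurable_mulmx_entry => [i l|i l]; first exact: measurable_cst.
apply: (measurableT_comp (f := fun A : 'cV[R]_d => A i l)); first exact: measurable_entry.
exact: measurable_fst.
Qed.

Lemma measurable_projected_set q : measurable (projected_set M q : set Z).
Proof.
apply: measurable_set_ler => //; apply: measurable_funM; last exact: measurable_snd.
apply: measurable_funD => //; apply: measurable_dot => [i j|i j]; first exact: measurable_cst.
by rewrite ord1; exact: measurable_entryM.
Qed.

Let measurable_size : measurable_fun setT size_.
Proof.
apply: measurable_funM; last by apply: measurableT_comp => //; exact: measurable_snd.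
apply: measurable_funD => //; apply: measurable_sum => j.
exact: measurableT_comp.
Qed.

Lemma projected_set_approx (D : probability Z R) (t : N.-tuple Z)
    (g : 'cV[R]_k) (b eta : R) : 0 < eta -> exists q,
  Pr D (projected_set M (g, b, 0)) - eta < Pr D (projected_set M (ratr_params R q)) /\
  frequency R (projected_set M (ratr_params R q)) t <=
    frequency R (projected_set M (g, b, 0)) t.
Proof.
move=> eta0; set F := projected_set M (g, b, 0).
have mF : measurable F by exact: measurable_projected_set.
pose K (l : nat) : set Z := [set z | size_ z <= l%:R].
have mK l : measurable (K l) by exact: measurable_set_ler.
have cvF : (fun l => Pr D (F `&` K l)) @ \oo --> Pr D F.
  have -> : Pr D F = Pr D (\bigcup_l (F `&` K l)).
    congr Pr; rewrite -setI_bigcupr (_ : \bigcup_l K l = setT) ?setIT//.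
    apply/seteqP; split => // z _; exists (Num.truncn (size_ z)).+1 => //=.
    by rewrite /K/= ltW// truncnS_gt.
  have mFK l : measurable (F `&` K l) by exact: measurableI.
  have mU : measurable (\bigcup_l (F `&` K l)) by exact: bigcup_measurable.
  apply: fine_cvg; rewrite fineK ?fin_num_measure//.
  apply: nondecreasing_cvg_mu => //.
  move=> l l' ll'; apply/subsetPset => z [Fz Kz]; split => //.
  by apply: le_trans Kz _; rewrite ler_nat.
(* The margin is controlled uniformly only where [size_] is bounded; [K l] must hold all but [eta]
   of the error mass, and the whole sample. *)
have [l Fl tl] : exists2 l : nat, Pr D F - eta < Pr D (F `&` K l) &
    forall n, size_ (tnth t n) <= l%:R.
  near \oo => l; exists l.
    near: l; apply: (cvgr_gt _ cvF); by rewrite ltrBlDr ltrDl.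
  move=> n; apply: (@le_trans _ _ (\sum_n size_ (tnth t n))).
    rewrite (bigD1 n)//= lerDl sumr_ge0// => i _.
    by rewrite mulr_ge0// addr_ge0// sumr_ge0.
  by near: l; exact: nbhs_infty_ger.
(* The least positive margin in the sample, capped at 1 so that it makes sense when no margin is
   positive. *)
pose tau : R := \big[Num.min/1]_(n < N | 0 < margin g b (tnth t n)) margin g b (tnth t n).
have tau0 : 0 < tau by rewrite /tau; elim/big_ind : _ => // x y x0 y0; rewrite lt_min x0.
have tauP n : 0 < margin g b (tnth t n) -> tau <= margin g b (tnth t n).
  by move=> h; exact: bigmin_le_cond.
(* On [K l] margins will move by at most [c < tau / 2]: those at most zero end at most [c], those at
   least [tau] stay above [c]. *)
have [|c] := @rat_in_itvoo R 0 (tau / 2); first by rewrite divr_gt0.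
rewrite in_itv/= => /andP[c0 ctau].
pose e : R := ratr c / (l.+1)%:R.
have e0 : 0 < e by rewrite divr_gt0.
have el (z : Z) : size_ z <= l%:R -> e * size_ z <= ratr c.
  move=> zl; rewrite /e mulrAC ler_pdivrMr ?ltr0n// ler_pM2l//.
  by apply: (le_trans zl); rewrite ler_nat.
pose g' : 'cV[rat]_k := \col_j sval (cid (exists_ratr_near (g j 0) e0)).
have g'P j : `|(map_mx ratr g' : 'cV[R]_k) j 0 - g j 0| <= e.
  by rewrite !mxE; exact: (svalP (cid (exists_ratr_near (g j 0) e0))).
have [b' b'P] := exists_ratr_near b e0.
exists (g', b', c).
have near z : size_ z <= l%:R ->
    `|margin (map_mx ratr g') (ratr b') z - margin g b z| <= ratr c.
  by move=> zl; apply: le_trans (el z zl); exact: margin_near.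
split.
  apply: (lt_le_trans Fl); apply: Pr_le.
  - exact: measurableI.
  - exact: measurable_projected_set.
  - move=> z [/= Fz /near]; rewrite ler_norml => /andP[_].
    have {}Fz : margin g b z <= 0 := Fz.
    by rewrite /projected_set/= -/(margin (map_mx ratr g') (ratr b') z); lra.
apply: frequency_le => n; rewrite /projected_set/= => h.
have := near _ (tl n); rewrite ler_norml => /andP[h1 _].
rewrite -/(margin (map_mx ratr g') (ratr b') (tnth t n)) in h.
change (margin g b (tnth t n) <= 0); rewrite leNgt; apply/negP => /tauP h2.
by lra.
Unshelve. all: by end_near.
Qed.

End projected_set_approximation.

(** * Flipping probabilities and the bad events *)

(** The derivative of [exp (2 x^2) (1 - x)] is [- exp (2 x^2) (2 x - 1)^2], never positive, so the
    function stays below its value 1 at zero. *)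
Lemma subr1_le_expR_sqr (R : realType) (s : R) : 0 <= s -> s <= 1 ->
  1 - s <= expR (- (2 * s ^+ 2)).
Proof.
move=> s0 s1.
pose f (x : R) := expR (2 * x ^+ 2) * (1 - x).
have df (x : R) : is_derive x 1 f (- (expR (2 * x ^+ 2) * (2 * x - 1) ^+ 2)).
  by apply: is_derive_eq; rewrite /GRing.scale/=; ring.
have f1 : f s <= f 0.
  apply: (@ler0_derive1_le_cc R f 0 1) => //; rewrite ?in_itv/= ?lexx ?ler01 ?s0//.
    move=> x _; rewrite derive1E derive_val oppr_le0.
    by rewrite mulr_ge0 ?expR_ge0 ?sqr_ge0.
  apply: derivable_within_continuous => x _; exact: ex_derive.
move: f1; rewrite /f expr0n/= mulr0 expR0 subr0 mulr1 => f1.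
by rewrite expRN -[leRHS]mul1r ler_pdivlMr ?expR_gt0// mulrC.
Qed.

(* Markov's inequality gives both terms of the minimum: [P (Y > F + s)] is at
   most [F / (F + s) <= 1 - s <= exp (- 2 s^2)] as long as [F + s <= 1]. *)
Lemma flip_penalty_exceeded d (T : measurableType d) (R : realType)
    (Q : probability T R) (Y : T -> R) (delta : R) :
  measurable_fun setT Y -> (forall x, 0 <= Y x) -> (forall x, Y x <= 1) ->
  0 < delta -> delta < 1 ->
  Pr Q [set x | flip_penalty delta (\int[Q]_x Y x) < Y x] <= delta.
Proof.
move=> mY Y0 Y1 d0 d1.
have bY : bounded_measurable Y.
  by split=> //; exists 1 => x; rewrite ger0_norm.
set F := \int[Q]_x Y x.
have F0 : 0 <= F by apply: Rintegral_ge0.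
have mE c : measurable [set x | c < Y x] by exact: measurable_set_ltr.
have markov c : c * Pr Q [set x | c < Y x] <= F.
  by apply: Pr_markov => // x /ltW.
rewrite /flip_penalty; set s := Num.sqrt _.
have l0 : 0 <= ln delta^-1 by rewrite ln_ge0// invf_ge1// ltW.
have s0 : 0 <= s by exact: sqrtr_ge0.
have dE : delta = expR (- (2 * s ^+ 2)).
  rewrite /s sqr_sqrtr; last by rewrite mulr_ge0.
  by rewrite mulrA divff// mul1r expRN lnK ?invrK// posrE invr_gt0.
have [_|_] := leP ((1 - delta) / delta * F) s.
  have -> : F + (1 - delta) / delta * F = F / delta by field; rewrite gt_eqF.
  (* For [F = 0] Markov's inequality at [F / delta] is empty; instead [0 < Y] is the countable union
     of the null events [1 / (n + 1) < Y]. *)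
  have [F00|F0'] := eqVneq F 0.
    rewrite F00 mul0r (_ : mkset _ = \bigcup_n [set x | n.+1%:R^-1 < Y x]); last first.
      apply/seteqP; split => [x /= Yx|x [n _ /=]]; last by apply: le_lt_trans.
      exists (Num.truncn (Y x)^-1) => //=.
      by rewrite invf_plt ?posrE// truncnS_gt.
    rewrite /Pr (_ : Q _ = 0%E) ?ltW//.
    apply/negligibleP; first exact: bigcup_measurable.
    apply: negligible_bigcup => n; apply/negligibleP => //.
    apply: (etrans (prob_fin Q (mE _))); congr EFin; apply/eqP; rewrite eq_le Pr_ge0 andbT.
    have := markov n.+1%:R^-1; rewrite F00 => h.
    by rewrite -(ler_pM2l (x := n.+1%:R^-1)) ?invr_gt0// mulr0.
  have Fd : 0 < F / delta by rewrite divr_gt0// lt_def F0' F0.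
  have := markov (F / delta); rewrite mulrAC ler_pdivrMr// ler_pM2l//.
  by rewrite lt_def F0' F0.
have [Fs|Fs] := leP 1 (F + s).
  rewrite (_ : mkset _ = set0) ?/Pr ?measure0 ?ltW//.
  apply/seteqP; split => // x /=; have := Y1 x; move=> h1 h2.
  by have := lt_le_trans (le_lt_trans Fs h2) h1; rewrite ltxx.
have s1 : s <= 1 by rewrite ltW//; lra.
rewrite [leRHS]dE; apply: le_trans (subr1_le_expR_sqr s0 s1).
have := markov (F + s); set p := Pr _ _ => h.
have p0 : 0 <= p by exact: Pr_ge0.
have p1 : p <= 1 by exact: Pr_le1.
(* Together with [(F + s) p <= F] this yields [p <= 1 - s] without dividing by [F + s]. *)
have : 0 <= (1 - p) * (1 - (F + s)) by rewrite mulr_ge0 ?subr_ge0// ltW.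
lra.
Qed.

(** * Conditioning on one of two independent variables *)

Section joint_law.
Context dO (Omega : measurableType dO) (R : realType) (P : probability Omega R).
Context d1 (T1 : measurableType d1) d2 (T2 : measurableType d2).

Lemma independent_joint_law (X : {RV P >-> T1}) (Y : {RV P >-> T2}) W :
  independent_pair P X Y -> measurable W ->
  P [set w | W (X w, Y w)] = (distribution P X \x distribution P Y)%E W.
Proof.
move=> XY mW.
have mXY : measurable_fun setT (fun w => (X w, Y w)) by exact: measurable_fun_pair.
pose mu : {measure set (T1 * T2) -> \bar R} := pushforward P (fun w => (X w, Y w)).
apply/esym; apply: (@product_measure_unique _ _ _ _ _ _ _ (mu mXY)) => // A B mA mB.
have mXA : measurable (X @^-1` A) by rewrite -[X in measurable X]setTI; exact: measurable_funP.
have mYB : measurable (Y @^-1` B) by rewrite -[X in measurable X]setTI; exact: measurable_funP.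
have := XY A B mA mB; rewrite /Pr => h.
change (P (X @^-1` A `&` Y @^-1` B) = P (X @^-1` A) * P (Y @^-1` B))%E.
by rewrite !prob_fin//; [rewrite /Pr h EFinM|exact: measurableI].
Qed.

Lemma Pr_joint_le (X : {RV P >-> T1}) (Y : {RV P >-> T2}) W (delta : R) :
  independent_pair P X Y -> measurable W ->
  (forall x, Pr (distribution P Y) [set y | W (x, y)] <= delta) ->
  Pr P [set w | W (X w, Y w)] <= delta.
Proof.
move=> XY mW Wd.
have sE x : xsection W x = [set y | W (x, y)].
  by apply/seteqP; split => y; rewrite /xsection/= inE.
have mWx x : measurable [set y | W (x, y)] by rewrite -sE; exact: measurable_xsection.
have W0 : 0 <= delta by apply: le_trans (Wd point); exact: Pr_ge0.
rewrite /Pr independent_joint_law// -lee_fin fineK; last first.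
  exact: (fin_num_measure ((distribution P X \x distribution P Y)%E : probability _ R) W mW).
apply: (@le_trans _ _ (\int[distribution P X]_x delta%:E)%E); last first.
  by rewrite integral_cst//= probability_setT mule1.
apply: ge0_le_integral => //.
- exact: measurable_fun_xsection.
- by move=> x _; rewrite /= sE prob_fin// lee_fin.
Qed.

End joint_law.

Lemma independent_pair_sym dO (Omega : measurableType dO) (R : realType)
    (P : probability Omega R) d1 (T1 : measurableType d1) d2 (T2 : measurableType d2)
    (X : Omega -> T1) (Y : Omega -> T2) :
  independent_pair P X Y -> independent_pair P Y X.
Proof. by move=> XY A B mA mB; rewrite setIC mulrC; exact: XY. Qed.

(** [S] may fail to be measurable; the inner event is the complement of the two bad ones. *)
Lemma with_probability_avoiding dO (Omega : measurableType dO) (R : realType)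
    (P : probability Omega R) (delta : R) (A B S : set Omega) :
  measurable A -> measurable B -> Pr P A <= delta -> Pr P B <= delta ->
  (forall w, ~ A w -> ~ B w -> S w) -> with_probability P (1 - 2 * delta) S.
Proof.
move=> mA mB PA PB ABS; exists (~` (A `|` B)); split.
- by apply: measurableC; exact: measurableU.
- rewrite PrC; last exact: measurableU.
  rewrite lerD2l lerN2 -lee_fin -prob_fin; last exact: measurableU.
  apply: le_trans (measureU2 _ _ _) _ => //; change (P A + P B <= (2 * delta)%:E)%E.
  by rewrite !prob_fin// -EFinD lee_fin mulrDl mul1r lerD.
- by move=> w /not_orP[]; exact: ABS.
Qed.

Section sections_measurability.
Context d1 (T : measurableType d1) d2 (Z : measurableType d2) (R : realType).
Variables (W : set (T * Z)) (mW : measurable W).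

Lemma measurable_slice x : measurable [set z | W (x, z)].
Proof.
rewrite (_ : mkset _ = xsection W x); first exact: measurable_xsection.
by apply/seteqP; split => z; rewrite /xsection/= inE.
Qed.

Lemma measurable_Pr_slice (D : probability Z R) :
  measurable_fun setT (fun x => Pr D [set z | W (x, z)]).
Proof.
rewrite (_ : (fun x => _) = fine \o (D \o xsection W)).
  apply: measurableT_comp => //; exact: measurable_fun_xsection.
apply/funext => x; rewrite /Pr/=; congr (fine (D _)).
by apply/seteqP; split => z; rewrite /xsection/= inE.
Qed.

Lemma measurable_frequency_slice (N : nat) :
  measurable_fun setT
    (fun p : T * N.-tuple Z => frequency R [set z | W (p.1, z)] p.2).
Proof.
apply: measurable_funM => //; apply: measurable_sum => n.
rewrite (_ : (fun p => _) = \1_W \o (fun p : T * N.-tuple Z => (p.1, tnth p.2 n))).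
  apply: measurableT_comp; first exact: measurable_indic.
  apply: measurable_fun_pair; first exact: measurable_fst.
  by apply: (measurableT_comp (measurable_tnth n)); exact: measurable_snd.
by apply/funext => p; rewrite /= !indicE.
Qed.

(** Both iterated integrals define measures that agree on rectangles, hence on [W]. *)
Lemma Rintegral_Pr_slice (PT : probability T R) (D : probability Z R) :
  \int[PT]_x Pr D [set z | W (x, z)] = \int[D]_z Pr PT [set x | W (x, z)].
Proof.
have xE x : [set z | W (x, z)] = xsection W x.
  by apply/seteqP; split => z; rewrite /xsection/= inE.
have yE z : [set x | W (x, z)] = ysection W z.
  by apply/seteqP; split => x; rewrite /ysection/= inE.
rewrite /Rintegral; congr fine.
transitivity (\int[PT]_x (D (xsection W x)))%E.
  by apply: eq_integral => x _; rewrite xE -prob_fin//; exact: measurable_xsection.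
transitivity (\int[D]_z (PT (ysection W z)))%E; last first.
  by apply: eq_integral => z _; rewrite yE -prob_fin//; exact: measurable_ysection.
apply: (@product_measure_unique _ _ _ _ _ PT D (PT \x^ D)%E) => // A B mA mB.
exact: product_measure2E.
Qed.

End sections_measurability.

(** A joint set of matrix and point: for a fixed point its probability over [M] is [f_k^+], for a
    fixed matrix its probability over the point is the flipped mass. *)
Definition flip_set (R : realType) (k d : nat) (h : 'cV[R]_d) :
    set ('M[R]_(k, d) * ('cV[R]_d * R)) :=
  [set p | projected_errs p.1 (p.1 *m h) 0 p.2 /\ 0 < dot h (p.2.2 *: p.2.1)].

(** [None] is the comparison classifier [(M h, 0)], which moves with [M] and need not be rational;
    including it lets one bad event serve both deviations. *)
Definition param_at (R : realType) (k d : nat) (h : 'cV[R]_d)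
    (i : option ('cV[rat]_k * rat * rat)) (M : 'M[R]_(k, d)) : 'cV[R]_k * R * R :=
  if i is Some q then ratr_params R q else (M *m h, 0, 0).

Definition deviation_set (R : realType) (k d N : nat)
    (D : probability ('cV[R]_d * R)%type R) (h : 'cV[R]_d) (eps : R) :
    set ('M[R]_(k, d) * N.-tuple ('cV[R]_d * R)) :=
  [set p | exists i, eps < `|frequency R (projected_set p.1 (param_at h i p.1)) p.2
                             - Pr D (projected_set p.1 (param_at h i p.1))|].

Section events.
Context (R : realType) (k d : nat).
Let MT := 'M[R]_(k, d).
Let Z := ('cV[R]_d * R)%type.
Variable h : 'cV[R]_d.

Let mM i j : measurable_fun setT (fun p : MT * Z => p.1 i j).
Proof.
apply: (measurableT_comp (f := fun A : MT => A i j)); first exact: measurable_entry.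
exact: measurable_fst.
Qed.

Let mx i j : measurable_fun setT (fun p : MT * Z => p.2.1 i j).
Proof.
apply: (measurableT_comp (f := fun A : 'cV[R]_d => A i j)); first exact: measurable_entry.
by apply: measurableT_comp => //; exact: measurable_snd.
Qed.

Let my : measurable_fun setT (fun p : MT * Z => p.2.2).
Proof. by apply: (measurableT_comp measurable_snd); exact: measurable_snd. Qed.

Let mMx i j : measurable_fun setT (fun p : MT * Z => (p.1 *m p.2.1) i j).
Proof. exact: measurable_mulmx_entry. Qed.

Let mMh i j : measurable_fun setT (fun p : MT * Z => (p.1 *m h) i j).
Proof. by apply: measurable_mulmx_entry => // l1 l2; exact: measurable_cst. Qed.

Lemma measurable_param_set i :
  measurable [set p : MT * Z | projected_set p.1 (param_at h i p.1) p.2].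
Proof.
apply: measurable_set_ler; last by case: i => [q|]; exact: measurable_cst.
apply: measurable_funM => //; apply: measurable_funD.
  by apply: measurable_dot => // l1 l2; case: i => [q|] //; exact: measurable_cst.
by case: i => [q|]; exact: measurable_cst.
Qed.

Lemma measurable_flip_set : measurable (@flip_set R k d h).
Proof.
rewrite (_ : flip_set h = [set p : MT * Z | projected_set p.1 (param_at h None p.1) p.2]
    `&` [set p : MT * Z | 0 < dot h (p.2.2 *: p.2.1)]).
  apply: measurableI; first exact: measurable_param_set.
  apply: measurable_set_ltr => //; apply: measurable_dot => [l1 l2|l1 l2].
    exact: measurable_cst.
  rewrite (_ : (fun p => _) = (fun p : MT * Z => p.2.2 * p.2.1 l1 l2)).
    exact: measurable_funM.
  by apply/funext => p; rewrite mxE.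
by [].
Qed.

Lemma measurable_deviation_set N (D : probability Z R) eps :
  measurable (@deviation_set R k d N D h eps).
Proof.
apply: measurable_set_exists => i; apply: measurable_set_ltr => //.
apply: measurableT_comp => //; apply: measurable_funB.
  exact: (measurable_frequency_slice (measurable_param_set i)).
apply: (measurableT_comp (measurable_Pr_slice (measurable_param_set i) D)).
exact: measurable_fst.
Qed.

End events.

Section dot_theory.
Context (R : realType) (d : nat).
Implicit Types u v : 'cV[R]_d.

Lemma dotZr a u v : dot u (a *: v) = dot u v * a.
Proof. by rewrite /dot -scalemxAr mxE mulrC. Qed.

Lemma flip_quadratic (k : nat) (M : 'M[R]_(k, d)) (h x : 'cV[R]_d) (y : R) :
  (h^T *m M^T *m M *m (y *: x)) 0 0 = dot (M *m h) (M *m x) * y.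
Proof. by rewrite /dot trmx_mul -!mulmxA -!scalemxAr mxE mulrC. Qed.

End dot_theory.

Lemma flip_prob_posE (R : realType) dO (Omega : measurableType dO)
    (P : probability Omega R) (k d : nat) (M : {RV P >-> 'M[R]_(k, d)})
    (h : 'cV[R]_d) (z : 'cV[R]_d * R) :
  flip_prob_pos P M h (z.2 *: z.1) =
  Pr (distribution P M) [set m | flip_set h (m, z)].
Proof.
rewrite /flip_prob_pos; case: (boolP (0 < _)) => hz; last first.
  rewrite mulr0 (_ : mkset _ = set0) ?/Pr ?measure0//.
  by apply/seteqP; split => // m [_]/=; rewrite (negbTE hz).
rewrite mulr1 /flip_prob; congr (fine (P _)); apply/seteqP.
by split => w /=; rewrite /flip_set/= /projected_errs flip_quadratic addr0 hz => // -[].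
Qed.

(** * Comparison with [(M h, 0)] for a fixed matrix and sample *)

Section deterministic.
Context (R : realType) (k d N : nat) (D : probability ('cV[R]_d * R)%type R).
Variables (M : 'M[R]_(k, d)) (t : N.-tuple ('cV[R]_d * R)) (h : 'cV[R]_d).

Lemma empirical_error_frequency (errs : 'cV[R]_d * R -> bool) :
  empirical_error errs t = frequency R [set z | errs z] t.
Proof.
congr (_ * _); apply: eq_bigr => n _; rewrite indicE; congr ((nat_of_bool _)%:R).
by apply/idP/idP; rewrite inE.
Qed.

(** Pass to a rational [q] dominating [(g, b, 0)]: it loses at most [eta] of risk, obeys the
    deviation bound, and has no larger empirical error; then minimality compares [(g, b)] with
    [(M h, 0)], and [eta] is arbitrary. *)
Lemma compressive_ERM_risk eps g b : compressive_ERM M t g b ->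
  ~ deviation_set D h eps (M, t) ->
  risk D (projected_errs M g b) <=
    empirical_error (projected_errs M (M *m h) 0) t + eps.
Proof.
move=> erm /forallNP dev; apply/ler_addgt0Pr => eta eta0.
have [q [Dq fq]] := projected_set_approx M D t g b eta0.
have := dev (Some q); rewrite /= => /negP; rewrite -leNgt ler_norml => /andP[devq _].
have := erm (M *m h) 0; rewrite (empirical_error_frequency (projected_errs M g b)).
move: Dq fq; rewrite /risk -/(projected_set M (g, b, 0)).
change [set z | projected_errs M g b z] with (projected_set M (g, b, 0)).
by lra.
Qed.

Lemma deviation_risk eps : ~ deviation_set D h eps (M, t) ->
  empirical_error (projected_errs M (M *m h) 0) t <=
    risk D (projected_errs M (M *m h) 0) + eps.
Proof.
move=> /forallNP/(_ None)/= /negP; rewrite -leNgt ler_norml => /andP[_].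
by rewrite lerBlDl empirical_error_frequency.
Qed.

Lemma projected_errs_flip z : projected_errs M (M *m h) 0 z ->
  linear_errs h z \/ flip_set h (M, z).
Proof.
rewrite /linear_errs -dotZr => Mz.
by have [h0|h0] := leP (dot h (z.2 *: z.1)) 0; [left|right].
Qed.

Lemma empirical_error_flip :
  empirical_error (projected_errs M (M *m h) 0) t <=
  empirical_error (linear_errs h) t + frequency R [set z | flip_set h (M, z)] t.
Proof.
rewrite /empirical_error /frequency /average -mulrDr ler_wpM2l ?invr_ge0//.
rewrite -big_split/=; apply: ler_sum => n _; rewrite indicE.
have [/projected_errs_flip[->|fl]|_] := boolP (projected_errs _ _ _ _).
- by rewrite lerDl.
- have /mem_set -> : [set z | flip_set h (M, z)] (tnth t n) by [].
  by rewrite lerDr.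
- by rewrite addr_ge0.
Qed.

Lemma risk_flip :
  risk D (projected_errs M (M *m h) 0) <=
  risk D (linear_errs h) + Pr D [set z | flip_set h (M, z)].
Proof.
have ml : measurable [set z | linear_errs h z].
  apply: measurable_set_ler => //; apply: measurable_funM; last exact: measurable_snd.
  apply: measurable_dot => [i j|i j]; first exact: measurable_cst.
  apply: (measurableT_comp (f := fun A : 'cV[R]_d => A i j)); first exact: measurable_entry.
  exact: measurable_fst.
have mf := measurable_slice (@measurable_flip_set R k d h) M.
have mp : measurable [set z | projected_errs M (M *m h) 0 z].
  exact: (measurable_slice (measurable_param_set h None) M).
rewrite /risk -lee_fin EFinD -!prob_fin//.
apply: (@le_trans _ _ (D ([set z | linear_errs h z] `|` [set z | flip_set h (M, z)]))).
  apply: le_measure; rewrite ?inE//; first exact: measurableU.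
  by move=> z /projected_errs_flip.
exact: measureU2.
Qed.

End deterministic.

Lemma iid_sample_law (R : realType) dO (Omega : measurableType dO)
    (P : probability Omega R) d (Z : measurableType d) (N : nat)
    (D : probability Z R) (TN : {RV P >-> N.-tuple Z}) :
  iid_sample D TN -> iid_law D (distribution P TN).
Proof.
move=> [ind law] A mA.
transitivity (Pr P [set w | forall n, A n (tnth (TN w) n)]); first by [].
rewrite (ind A mA); apply: eq_bigr => n _.
by rewrite /Pr -(law n).
Qed.

(** With [l = ln (1 / delta)], [24 (k + 2 + l) <= 7^2 (k + 1 + l)], whence [224 = 32 * 7]. *)
Lemma complexity_ge (R : realType) (k N : nat) (delta : R) :
  0 < delta -> delta < 1 ->
  32 * Num.sqrt (24 * ((k + 2)%:R + ln delta^-1) / N%:R) <=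
  224 * complexity k N delta.
Proof.
move=> d0 d1; have l0 : 0 <= ln delta^-1 by rewrite ln_ge0// invf_ge1// ltW.
have -> : 224 * complexity k N delta = 32 * (7 * complexity k N delta) by ring.
rewrite ler_pM2l// /complexity.
have -> : 7 = Num.sqrt (7 ^+ 2) :> R by rewrite sqrtr_sqr ger0_norm.
rewrite -sqrtrM ?sqr_ge0// ler_sqrt; last first.
  by rewrite mulr_ge0 ?sqr_ge0// divr_ge0// !addr_ge0.
rewrite mulrA ler_wpM2r ?invr_ge0// natrD.
have : 0 <= k%:R :> R by [].
by lra.
Qed.

Theorem theorem2p1 (R : realType) :
  exists2 c : R, 0 < c &
  forall (d k N : nat) (le_kd : (k <= d)%N) (N_gt0 : (0 < N)%N)
    (* the data distribution D on X x {-1, 1} *)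
    (X : set 'cV[R]_d) (mX : measurable X)
    (D : probability ('cV[R]_d * R)%type R)
    (D_supp : D (X `*` [set -1; 1]) = 1%E)
    (* the training set and the projection matrix *)
    (dO : measure_display) (Omega : measurableType dO)
    (P : probability Omega R)
    (TN : {RV P >-> N.-tuple ('cV[R]_d * R)%type})
    (TN_iid : iid_sample D TN)
    (M : {RV P >-> 'M[R]_(k, d)})
    (dX : measure_display) (OmegaX : measurableType dX)
    (PX : probability OmegaX R) (xi : {RV PX >-> R})
    (xi_subg : subgaussian xi)
    (M_iid : iid_entries M (distribution PX xi))
    (M_TN_indep : independent_pair P M TN)
    (delta : R) (delta_gt0 : 0 < delta) (delta_lt1 : delta < 1)
    (* the compressive ERM classifier *)
    (hhat : Omega -> 'cV[R]_k) (b : Omega -> R)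
    (hhat_ERM : forall w, compressive_ERM (M w) (TN w) (hhat w) (b w)),
  (forall h : 'cV[R]_d,
     with_probability P (1 - 2 * delta) [set w |
       risk D (projected_errs (M w) (hhat w) (b w)) <=
         empirical_error (linear_errs h) (TN w)
         + c * complexity k N delta
         + flip_penalty delta
             (average (fun n : 'I_N =>
                let z := tnth (TN w) n in
                flip_prob_pos P M h (z.2 *: z.1)))])
  /\
  (forall hstar : 'cV[R]_d, optimal_linear D hstar ->
     with_probability P (1 - 2 * delta) [set w |
       risk D (projected_errs (M w) (hhat w) (b w)) <=
         risk D (linear_errs hstar)
         + 2 * c * complexity k N delta
         + flip_penalty delta
             (fine ('E_D[fun z => flip_prob_pos P M hstar (z.2 *: z.1)])%E)]).
Proof.
have empirical_chain (r e e' t p c c' : R) : r <= e' + c -> e' <= e + t -> t <= p ->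
    c <= c' -> r <= e + c' + p by lra.
have risk_chain (r e' r' r0 t p c c' : R) : r <= e' + c -> e' <= r' + c -> r' <= r0 + t ->
    t <= p -> c <= 224 * c' -> r <= r0 + 2 * 224 * c' + p by lra.
exists 224 => // d k N _ N0 _ _ D _ dO Omega P TN TN_iid M _ _ _ _ _ _ M_TN
  delta d0 d1 hhat b erm.
pose eps : R := 32 * Num.sqrt (24 * ((k + 2)%:R + ln delta^-1) / N%:R).
have eps_le : eps <= 224 * complexity k N delta by exact: complexity_ge.
have Q_iid := iid_sample_law TN_iid.
have mpre d' (T' : measurableType d') (X : {RV P >-> T'}) A :
    measurable A -> measurable [set w | A (X w)].
  by move=> mA; rewrite -[X in measurable X]setTI; exact: measurable_funP.
have mMT : measurable_fun setT (fun w => (M w, TN w)) by exact: measurable_fun_pair.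
have mpair A : measurable A -> measurable [set w | A (M w, TN w)].
  by move=> mA; have := mMT measurableT _ mA; rewrite setTI.
pose bad h := [set w | deviation_set D h eps (M w, TN w)].
have mbad h : measurable (bad h) 
  by apply: (mpair (deviation_set D h eps)); exact: measurable_deviation_set.
have Pbad h : Pr P (bad h) <= delta.
  apply: (@Pr_joint_le _ _ _ _ _ _ _ _ _ _ (deviation_set D h eps)) => //.
    exact: measurable_deviation_set.
  move=> m; rewrite /deviation_set/= /eps.
  pose B i := projected_set m (param_at h i m).
  apply: (@vc_deviation _ _ R N (k + 2) D (distribution P TN) _ B) => //.
  - by rewrite addn2.
  - by move=> i; exact: measurable_projected_set.
  - exact: vc_projected_set.
split=> [h|hstar _].
- pose W := @flip_set R k d h.
  have mW : measurable W by exact: measurable_flip_set.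
  pose F (t : N.-tuple ('cV[R]_d * R)) := average (fun n =>
    Pr (distribution P M) [set m | W (m, tnth t n)]).
  pose T (p : 'M[R]_(k, d) * N.-tuple ('cV[R]_d * R)) :=
    frequency R [set z | W (p.1, z)] p.2.
  pose bad2 := [set p | flip_penalty delta (F p.2) < T p].
  have mF : measurable_fun setT F.
    apply: measurable_funM => //; apply: measurable_sum => n.
    have mW' : measurable [set q : ('cV[R]_d * R) * 'M[R]_(k, d) | W (q.2, q.1)].
      have := @measurable_swap _ _ _ _ measurableT W mW.
      by rewrite setTI.
    apply: (measurableT_comp (measurable_Pr_slice mW' _)).
    exact: measurable_tnth.
  have mpen : measurable_fun setT (fun x : R => flip_penalty delta x).
    by apply: measurable_funD => //; apply: measurable_minr => //; exact: measurable_funM.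
  have mbad2 : measurable bad2.
    apply: measurable_set_ltr.
      by apply: (measurableT_comp mpen); apply: (measurableT_comp mF); exact: measurable_snd.
    exact: measurable_frequency_slice.
  apply: (with_probability_avoiding (mbad h) (mpair _ mbad2) (Pbad h)).
    (* The components are exchanged so that the sample is frozen and the matrix random. *)
    pose bad2' := [set q | bad2 (q.2, q.1)].
    apply: (@Pr_joint_le _ _ _ P _ _ _ _ TN M bad2').
    - exact: independent_pair_sym.
    - have := @measurable_swap _ _ _ _ measurableT bad2 mbad2.
      by rewrite setTI.
    - move=> t; rewrite /bad2' /bad2/=.
      have bT n : bounded_measurable (fun m => \1_[set z | W (m, z)] (tnth t n) : R).
        rewrite (_ : (fun m => _) = \1_[set m | W (m, tnth t n)]).
          apply: bounded_measurable_indic.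
          rewrite (_ : mkset _ = ysection W (tnth t n)); first exact: measurable_ysection.
          by apply/seteqP; split => m; rewrite /ysection/= inE.
        by apply/funext => m; rewrite !indicE.
      have -> : F t = \int[distribution P M]_m T (m, t).
        rewrite /T /F /frequency /average RintegralZl//=; last first.
          exact/bounded_measurable_integrable/bounded_measurable_sum.
        congr (_ * _); rewrite Rintegral_sum//; apply: eq_bigr => n _.
        rewrite -Rintegral_indic; last first.
          rewrite (_ : mkset _ = ysection W (tnth t n)); first exact: measurable_ysection.
          by apply/seteqP; split => m; rewrite /ysection/= inE.
        by apply: eq_Rintegral => m _; rewrite !indicE.
      apply: flip_penalty_exceeded => //.
      + apply: measurable_funM => //; apply: measurable_sum => n.
        by have [] := bT n.
      + move=> m; rewrite mulr_ge0 ?invr_ge0 ?sumr_ge0// => n _.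
      + move=> m; rewrite /T /frequency /average ler_pdivrMl ?ltr0n// mulr1.
        apply: (@le_trans _ _ (\sum_(n < N) 1)); last by rewrite sumr_const card_ord.
        apply: ler_sum => n _.
        by rewrite indicE; case: (_ \in _).
  move=> w nbad /negP; rewrite -leNgt /T /F /= => flip.
  have FE : average (fun n => let z := tnth (TN w) n in flip_prob_pos P M h (z.2 *: z.1))
      = average (fun n => Pr (distribution P M) [set m | W (m, tnth (TN w) n)]).
    by congr (_ * _); apply: eq_bigr => n _; exact: flip_prob_posE.
  rewrite FE; apply: (empirical_chain _ _ _ _ _ _ _ _ _ flip eps_le).
    exact: compressive_ERM_risk (erm w) nbad.
  exact: empirical_error_flip.
- pose W := @flip_set R k d hstar.
  have mW : measurable W by exact: measurable_flip_set.
  pose T (m : 'M[R]_(k, d)) := Pr D [set z | W (m, z)].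
  have mT : measurable_fun setT T by exact: measurable_Pr_slice.
  (* Exchanging [M] and the fresh point turns the expected flipping probability into the mean over
     [M] of the flipped mass [T], so the second bad event depends on [M] alone. *)
  have -> : fine ('E_D[fun z => flip_prob_pos P M hstar (z.2 *: z.1)])%E
      = \int[distribution P M]_m T m.
    rewrite Rintegral_Pr_slice// unlock /Rintegral; congr fine.
    by apply: eq_integral => z _; rewrite /= flip_prob_posE.
  set F := \int[_]_m _.
  pose bad2 := [set m | flip_penalty delta F < T m].
  have mbad2 : measurable bad2 by exact: measurable_set_ltr.
  apply: (with_probability_avoiding (mbad hstar) (mpre _ _ M _ mbad2) (Pbad hstar)).
    apply: (@flip_penalty_exceeded _ _ _ (distribution P M)) => //.
    - by move=> m; exact: Pr_ge0.
    - by move=> m; apply: Pr_le1; exact: measurable_slice.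
  move=> w nbad /negP; rewrite -leNgt /T => flip.
  apply: (risk_chain _ _ _ _ _ _ _ _ _ _ _ flip eps_le).
  - exact: compressive_ERM_risk (erm w) nbad.
  - exact: deviation_risk nbad.
  - exact: risk_flip.
Qed.
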